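(* Fix $T>0$, an acceleration factor $\delta\in(0,1]$, delays $0\le\tau_1\le\tau_2\le T$, and noise level $\sigma_0^2>0$, and let $P_1,P_2>0$. Let $g(t)=\int_{-\infty}^{\infty}p(s)p^*(s-t)\,ds$ be the autocorrelation of the transmit pulse $p$, and define, for $\lambda\in[-\tfrac12,\tfrac12]$, $$G_\delta(\lambda)=\sum_{n=-\infty}^{\infty} g(n\delta T)e^{j2\pi\lambda n},\qquad G_{12,\delta}(\lambda)=\sum_{n=-\infty}^{\infty} g\big(n\delta T+(\tau_1-\tau_2)\big)e^{j2\pi\lambda n}.$$ For data power spectra $S_{a1},S_{a2}$ (real, nonnegative, even functions on $[-\tfrac12,\tfrac12]$ with absolutely summable Fourier coefficients $r_k[n]=\int_{-1/2}^{1/2}S_{ak}(\lambda)e^{j2\pi\lambda n}d\lambda$), let $\bm{R}_{k,N}$ be the $N\times N$ Toeplitz matrix with entries $(\bm{R}_{k,N})_{n,m}=r_k[n-m]$, let $\bm{G}_N$ be the $N\times N$ matrix with entries $g((n-m)\delta T)$, $\bm{G}_{12,N}$ the $N\times N$ matrix with entries $g((n-m)\delta T+(\tau_1-\tau_2))$, $\bm{G}_{21,N}=\bm{G}_{12,N}^\dagger$, and $$\tilde{\bm{G}}_N=\begin{bmatrix}\bm{G}_N&\bm{G}_{12,N}\\ \bm{G}_{21,N}&\bm{G}_N\end{bmatrix},\qquad \tilde{\bm{R}}_N=\begin{bmatrix}\bm{R}_{1,N}&\bm{0}\\ \bm{0}&\bm{R}_{2,N}\end{bmatrix}.$$ Define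 the capacity region $$C=\bigcup\Big\{(R_1,R_2):\ 0\le R_1\le \lim_{N\to\infty}\tfrac{1}{2N}\log_2\det(\bm{I}_N+\sigma_0^{-2}\bm{G}_N\bm{R}_{1,N}),\ 0\le R_2\le \lim_{N\to\infty}\tfrac{1}{2N}\log_2\det(\bm{I}_N+\sigma_0^{-2}\bm{G}_N\bm{R}_{2,N}),\ 0\le R_1+R_2\le \lim_{N\to\infty}\tfrac{1}{2N}\log_2\det(\bm{I}_{2N}+\sigma_0^{-2}\tilde{\bm{G}}_N\tilde{\bm{R}}_N)\Big\},$$ the union being over all admissible pairs $(S_{a1},S_{a2})$ satisfying the power constraints $\frac{1}{\delta T}\int_{-1/2}^{1/2}G_\delta(\lambda)S_{ak}(\lambda)\,d\lambda\le P_k$, $k=1,2$. Then, writing $S_k(\lambda)=G_\delta(\lambda)S_{ak}(\lambda)$, $$C=\bigcup\Big\{(R_1,R_2):\ R_1\le \tfrac12\int_{-1/2}^{1/2}\log_2\big(1+\sigma_0^{-2}S_1(\lambda)\big)d\lambda,\ R_2\le \tfrac12\int_{-1/2}^{1/2}\log_2\big(1+\sigma_0^{-2}S_2(\lambda)\big)d\lambda,$$ $$R_1+R_2\le \tfrac12\int_{-1/2}^{1/2}\log_2\Big(1+\sigma_0^{-2}S_1(\lambda)+\sigma_0^{-2}S_2(\lambda)+\sigma_0^{-4}S_1(\lambda)S_2(\lambda)\Big[1-\Big|\tfrac{G_{12,\delta}(\lambda)}{G_\delta(\lambda)}\Big|^2\Big]\Big)d\lambda\Big\},$$ the union again over the same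 admissible pairs $(S_{a1},S_{a2})$ (all three limits defining $C$ exist and equal the corresponding integrals).
   Context: Setting: two-user asynchronous multiple access channel with faster-than-Nyquist (FTN) signaling. User $k$ transmits $x_k(t)=\sum_{m=0}^{N-1}a_k[m]p(t-m\delta T-\tau_k)$; the receiver adds white Gaussian noise of spectral density $\sigma_0^2$, applies the matched filter $p^*(-t)$ and samples at $n\delta T+\tau_k$, $n=0,\dots,N-1$, $k=1,2$, giving $\bm{y}=\tilde{\bm{G}}_N\bm{a}+\bm{\eta}$ with noise covariance $\sigma_0^2\tilde{\bm{G}}_N$. Inputs of the two users are independent stationary Gaussian processes with autocorrelations $r_k[n]=\mathbb{E}[a_k[m+n]a_k^*[m]]$ and data spectra $S_{ak}(\lambda)=\sum_n r_k[n]e^{-j2\pi\lambda n}$; the log-det expressions in the claim are the normalized mutual informations $I(\bm a_1;\bm y\mid\bm a_2)$, $I(\bm a_2;\bm y\mid\bm a_1)$, $I(\bm a_1,\bm a_2;\bm y)$ for such inputs. The pulse autocorrelation $g$ is assumed such that the sequences $g(n\delta T)$ and $g(n\delta T+s)$ are absolutely summable (e.g. $p$ a root raised cosine pulse, so $g$ is a raised cosine pulse).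
   Formalization: The integral-form region is also restricted by 0≤R_1, 0≤R_2, 0≤R_1+R_2, since without this it contains negative rate pairs such as (-1,-1), which are not in C. *)

(* Defs.v *)
From HB Require Import structures.
From mathcomp Require Import all_boot all_order all_algebra.
From mathcomp Require Import all_classical all_reals all_analysis.
From mathcomp Require Import complex.
Set Implicit Arguments. Unset Strict Implicit. Unset Printing Implicit Defensive.
Import Order.TTheory GRing.Theory Num.Theory.
Import numFieldNormedType.Exports.
Local Open Scope classical_set_scope.
Local Open Scope ring_scope.

Section FTNMAC.
Variable R : realType.
Local Notation C := (R[i]).
Local Notation Re := (@complex.Re R).
Local Notation Im := (@complex.Im R).
Local Notation Complex := (@complex.Complex R).

Definition conjc (z : C) : C := Complex (Re z) (- Im z).
Definition cnorm2 (z : C) : R := Re z ^+ 2 + Im z ^+ 2.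
Definition cabs (z : C) : R := Num.sqrt (cnorm2 z).
Definition rC (x : R) : C := Complex x 0.
Definition expj (x : R) : C := Complex (cos x) (sin x).
Definition log2 (x : R) : R := ln x / ln 2.

Definition Rint (D : set R) (f : R -> R) : R := Rintegral lebesgue_measure D f.
Definition Ihalf : set R := `[(- (1/2))%R, (1/2)%R]%classic.

Definition zsumR (a : int -> R) : R :=
  limn (fun N : nat => \sum_(n < N) a (n%:Z))
  + limn (fun N : nat => \sum_(n < N) a (- (n.+1)%:Z)).
Definition zsumC (a : int -> C) : C :=
  Complex (zsumR (fun n => Re (a n))) (zsumR (fun n => Im (a n))).
Definition abs_summable_Z (a : int -> C) : Prop :=
  exists M : R, forall N : nat,
    \sum_(i < N) (cabs (a (i%:Z)) + cabs (a (- (i.+1)%:Z))) <= M.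

(* ---------- pulse autocorrelation g(t) = int p(s) p^*(s-t) ds, p = pr + j pim ---------- *)
Definition autocorr (pr pim : R -> R) (t : R) : C :=
  Complex (Rint setT (fun s => pr s * pr (s - t) + pim s * pim (s - t)))
          (Rint setT (fun s => pim s * pr (s - t) - pr s * pim (s - t))).

Definition Gdelta (g : R -> C) (delta T lam : R) : C :=
  zsumC (fun n => g (n%:~R * delta * T) * expj (2 * pi * lam * n%:~R)).
Definition G12delta (g : R -> C) (delta T tau1 tau2 lam : R) : C :=
  zsumC (fun n => g (n%:~R * delta * T + (tau1 - tau2)) * expj (2 * pi * lam * n%:~R)).

Definition rcoef (S : R -> R) (n : int) : C :=
  Complex (Rint Ihalf (fun l => S l * cos (2 * pi * l * n%:~R)))
          (Rint Ihalf (fun l => S l * sin (2 * pi * l * n%:~R))).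

Definition RN (S : R -> R) (N : nat) : 'M[C]_N :=
  \matrix_(i < N, j < N) rcoef S (i%:Z - j%:Z).
Definition GN (g : R -> C) (delta T : R) (N : nat) : 'M[C]_N :=
  \matrix_(i < N, j < N) g ((i%:Z - j%:Z)%:~R * delta * T).
Definition G12N (g : R -> C) (delta T tau1 tau2 : R) (N : nat) : 'M[C]_N :=
  \matrix_(i < N, j < N) g ((i%:Z - j%:Z)%:~R * delta * T + (tau1 - tau2)).
Definition G21N (g : R -> C) (delta T tau1 tau2 : R) (N : nat) : 'M[C]_N :=
  \matrix_(i < N, j < N) conjc (G12N g delta T tau1 tau2 N j i).
Definition GtildeN (g : R -> C) (delta T tau1 tau2 : R) (N : nat) : 'M[C]_(N + N) :=
  block_mx (GN g delta T N) (G12N g delta T tau1 tau2 N)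
           (G21N g delta T tau1 tau2 N) (GN g delta T N).
Definition RtildeN (S1 S2 : R -> R) (N : nat) : 'M[C]_(N + N) :=
  block_mx (RN S1 N) 0 0 (RN S2 N).

(* (1/(2N)) log2 det(I + sigma0^{-2} A); det is real positive for the matrices
   considered, we take its real part *)
Definition nlogdet (n N : nat) (s2 : R) (A : 'M[C]_n) : R :=
  (2 * N%:R)^-1 * log2 (Re (\det (1%:M + rC s2^-1 *: A))).

Definition rate1_N g delta T s2 S1 (N : nat) : R :=
  nlogdet N s2 (GN g delta T N *m RN S1 N).
Definition rate2_N g delta T s2 S2 (N : nat) : R :=
  nlogdet N s2 (GN g delta T N *m RN S2 N).
Definition ratesum_N g delta T tau1 tau2 s2 S1 S2 (N : nat) : R :=
  nlogdet N s2 (GtildeN g delta T tau1 tau2 N *m RtildeN S1 S2 N).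

Definition admissible (g : R -> C) (delta T P : R) (S : R -> R) : Prop :=
  [/\ (forall l, Ihalf l -> 0 <= S l),
      (forall l, Ihalf l -> S (- l) = S l),
      lebesgue_measure.-integrable Ihalf (EFin \o S),
      abs_summable_Z (rcoef S) &
      (delta * T)^-1 * Rint Ihalf (fun l => Re (Gdelta g delta T l) * S l) <= P].

(* S_k(lambda) = G_delta(lambda) S_ak(lambda)  (G_delta is real) *)
Definition Seff g delta T (S : R -> R) (l : R) : R := Re (Gdelta g delta T l) * S l.

Definition int_rate1 g delta T s2 S1 : R :=
  2^-1 * Rint Ihalf (fun l => log2 (1 + s2^-1 * Seff g delta T S1 l)).
Definition int_rate2 g delta T s2 S2 : R :=
  2^-1 * Rint Ihalf (fun l => log2 (1 + s2^-1 * Seff g delta T S2 l)).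
Definition int_ratesum g delta T tau1 tau2 s2 S1 S2 : R :=
  2^-1 * Rint Ihalf (fun l =>
    log2 (1 + s2^-1 * Seff g delta T S1 l + s2^-1 * Seff g delta T S2 l
          + s2^-2 * Seff g delta T S1 l * Seff g delta T S2 l
            * (1 - cnorm2 (G12delta g delta T tau1 tau2 l)
                   / (Re (Gdelta g delta T l)) ^+ 2))).

Definition region_lim g delta T tau1 tau2 s2 P1 P2 : set (R * R) :=
  [set x | exists S1 S2, admissible g delta T P1 S1 /\ admissible g delta T P2 S2 /\
     [/\ 0 <= x.1 <= limn (rate1_N g delta T s2 S1),
         0 <= x.2 <= limn (rate2_N g delta T s2 S2) &
         0 <= x.1 + x.2 <= limn (ratesum_N g delta T tau1 tau2 s2 S1 S2)]].

Definition region_int g delta T tau1 tau2 s2 P1 P2 : set (R * R) :=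
  [set x | exists S1 S2, admissible g delta T P1 S1 /\ admissible g delta T P2 S2 /\
     [/\ 0 <= x.1 <= int_rate1 g delta T s2 S1,
         0 <= x.2 <= int_rate2 g delta T s2 S2 &
         0 <= x.1 + x.2 <= int_ratesum g delta T tau1 tau2 s2 S1 S2]].

End FTNMAC.

(* Main.v *)
(* All three limits are instances of one statement (take S2 = 0 for the
   single-user rates): a Szego theorem for the product of the 2x2-block Toeplitz
   matrices of the pulse and of the data. Both factors are positive
   semidefinite, the first as a Gram matrix of shifted pulses, the second as a
   Gram matrix of exponentials weighted by the data spectra. Hence the product,
   like its symbol, has real eigenvalues in a fixed interval [0, B], on which
   ln (1 + c x) is uniformly approximated by polynomials. It remains to see that
   normalized traces of powers converge to the integral of the trace of the
   powers of the symbol: away from the first and last rows, the entries of a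
   product of Toeplitz matrices are close to the Fourier coefficients of the
   product of the symbols.
   The rates in the claim involve the spectra themselves rather than their
   Fourier series. That an even integrable function is determined almost
   everywhere by its cosine coefficients follows by testing against the
   polynomials (1 - u^n)^(2^n) in u = 1/2 + (cos(2 pi l) - cos(2 pi x)) / 4,
   which converge boundedly to the indicator of |l| > x. *)
Require Import Defs.
From HB Require Import structures.
From mathcomp Require Import all_boot all_order all_algebra.
From mathcomp Require Import all_classical all_reals all_analysis.
From mathcomp Require Import measurable_realfun complex spectral.
From mathcomp Require Import zify ring lra.
Set Implicit Arguments. Unset Strict Implicit. Unset Printing Implicit Defensive.
Import Order.TTheory GRing.Theory Num.Theory.
Import numFieldNormedType.Exports.
Local Open Scope classical_set_scope.
Local Open Scope ring_scope.

(** A product of two positive semidefinite matrices is in general not normal, and either factor may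
    be singular: in faster-than-Nyquist signaling [Gdelta] may vanish. Hence there is no reduction
    to a Hermitian matrix through an inverse; a Schur triangulation supplies the eigenvalues, and
    their reality and sign come from testing eigenvectors against both quadratic forms. The symbol
    must obey the same bounds as the matrices. Its positivity is not assumed but inherited:
    quadratic forms at vectors of exponentials are Fejér means of the symbol. Two mismatches with
    the stated rates remain. A data spectrum is merely integrable and agrees with its Fourier series
    only almost everywhere, so the two can be exchanged only under the integral. And the sum rate
    divides by [Gdelta]; where this vanishes, positivity of the 2x2 symbol forces [G12delta] to
    vanish too, so the formula with inverse of zero equal to zero still gives the determinant. *)

Local Notation Re := complex.Re.
Local Notation Im := complex.Im.
Local Notation Complex := complex.Complex.
Local Notation Rint := Defs.Rint.
Local Notation Ihalf := (@Defs.Ihalf _).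

(** * Modulus, conjugation and complex exponentials *)

Section ComplexModulus.
Variable R : realType.
Local Notation C := (R[i]).
Implicit Types (z w : C) (x y : R).

Lemma complex_ext z w : Re z = Re w -> Im z = Im w -> z = w.
Proof. by case: z; case: w => ? ? ? ? /= -> ->. Qed.

Lemma RecD z w : Re (z + w) = Re z + Re w. Proof. by case: z; case: w. Qed.
Lemma ImcD z w : Im (z + w) = Im z + Im w. Proof. by case: z; case: w. Qed.
Lemma RecN z : Re (- z) = - Re z. Proof. by case: z. Qed.
Lemma ImcN z : Im (- z) = - Im z. Proof. by case: z. Qed.
Lemma RecB z w : Re (z - w) = Re z - Re w. Proof. by rewrite RecD RecN. Qed.
Lemma ImcB z w : Im (z - w) = Im z - Im w. Proof. by rewrite ImcD ImcN. Qed.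
Lemma RecM z w : Re (z * w) = Re z * Re w - Im z * Im w.
Proof. by case: z; case: w. Qed.
Lemma ImcM z w : Im (z * w) = Re z * Im w + Im z * Re w.
Proof. by case: z; case: w. Qed.
Lemma Re_conj z : Re (Defs.conjc z) = Re z. Proof. by []. Qed.
Lemma Im_conj z : Im (Defs.conjc z) = - Im z. Proof. by []. Qed.

Definition ReImE := (RecD, ImcD, RecN, ImcN, RecM, ImcM, Re_conj, Im_conj).

Lemma Re_sum I (r : seq I) (P : pred I) (F : I -> C) :
  Re (\sum_(i <- r | P i) F i) = \sum_(i <- r | P i) Re (F i).
Proof. exact: (big_morph _ RecD). Qed.

Lemma Im_sum I (r : seq I) (P : pred I) (F : I -> C) :
  Im (\sum_(i <- r | P i) F i) = \sum_(i <- r | P i) Im (F i).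
Proof. exact: (big_morph _ ImcD). Qed.

Lemma conjcE z : Defs.conjc z = z^*.
Proof. by case: z. Qed.

Lemma rC_is_real_complex : @rC R = real_complex R. Proof. by []. Qed.

Lemma normC_cabs z : `|z| = rC (cabs z). Proof. by case: z. Qed.

Lemma rC_le x y : (rC x <= rC y) = (x <= y). Proof. exact: lecR. Qed.
Lemma rCD x y : rC (x + y) = rC x + rC y. Proof. exact: (rmorphD (real_complex R)). Qed.
Lemma rCM x y : rC (x * y) = rC x * rC y. Proof. exact: (rmorphM (real_complex R)). Qed.
Lemma rCN x : rC (- x) = - rC x. Proof. exact: (rmorphN (real_complex R)). Qed.
Lemma rC_inj : injective (@rC R). Proof. by move=> x y []. Qed.

Lemma cabs_ge0 z : 0 <= cabs z. Proof. exact: sqrtr_ge0. Qed.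
Lemma cabs0 : cabs (0 : C) = 0.
Proof. by apply: rC_inj; rewrite -normC_cabs normr0. Qed.
Lemma cabs1 : cabs (1 : C) = 1.
Proof. by apply: rC_inj; rewrite -normC_cabs normr1. Qed.
Lemma cabsM z w : cabs (z * w) = cabs z * cabs w.
Proof. by apply: rC_inj; rewrite rCM -!normC_cabs normrM. Qed.
Lemma cabsD z w : cabs (z + w) <= cabs z + cabs w.
Proof. by rewrite -rC_le rCD -!normC_cabs ler_normD. Qed.
Lemma cabsN z : cabs (- z) = cabs z.
Proof. by apply: rC_inj; rewrite -!normC_cabs normrN. Qed.
Lemma cabsB z w : cabs (z - w) <= cabs z + cabs w.
Proof. by rewrite -[cabs w]cabsN cabsD. Qed.
Lemma cabs_conj z : cabs (Defs.conjc z) = cabs z.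
Proof. by rewrite /cabs /cnorm2 /= sqrrN. Qed.
Lemma cabs_rC x : cabs (rC x) = `|x|.
Proof. by rewrite /cabs /cnorm2 /= expr0n /= addr0 sqrtr_sqr. Qed.

Lemma cabs_sum I (r : seq I) (P : pred I) (F : I -> C) :
  cabs (\sum_(i <- r | P i) F i) <= \sum_(i <- r | P i) cabs (F i).
Proof.
elim/big_ind2 : _ => //; first by rewrite cabs0.
by move=> a b c d h1 h2; apply: le_trans (cabsD _ _) _; exact: lerD.
Qed.

Lemma Re_cabs z : `|Re z| <= cabs z.
Proof.
by rewrite /cabs /cnorm2 -[leLHS]sqrtr_sqr ler_wsqrtr// lerDl sqr_ge0.
Qed.

Lemma Im_cabs z : `|Im z| <= cabs z.
Proof.
by rewrite /cabs /cnorm2 -[leLHS]sqrtr_sqr ler_wsqrtr// lerDr sqr_ge0.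
Qed.

Lemma cabs_ReIm z : cabs z <= `|Re z| + `|Im z|.
Proof.
rewrite -[leRHS]ger0_norm ?addr_ge0// -sqrtr_sqr ler_wsqrtr// /cnorm2.
rewrite -(real_normK (num_real (Re z))) -(real_normK (num_real (Im z))).
by rewrite sqrrD addrAC lerDl mulrn_wge0// mulr_ge0.
Qed.

Lemma cabs_eq0 z : cabs z = 0 -> z = 0.
Proof. by move=> h; apply/eqP; rewrite -normr_eq0 normC_cabs h. Qed.

Lemma mulC_conj z : z * Defs.conjc z = rC (cabs z ^+ 2).
Proof.
rewrite /cabs sqr_sqrtr /cnorm2; last by rewrite addr_ge0 ?sqr_ge0.
by apply: complex_ext; rewrite !ReImE /=; ring.
Qed.

Lemma expjD x y : expj (x + y) = expj x * expj y.
Proof. by apply: complex_ext; rewrite !ReImE /= ?cosD ?sinD//; ring. Qed.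
Lemma expj0 : expj (0 : R) = 1.
Proof. by apply: complex_ext; rewrite /= ?cos0 ?sin0. Qed.
Lemma expjN x : expj (- x) = Defs.conjc (expj x).
Proof. by apply: complex_ext; rewrite /= ?cosN ?sinN. Qed.
Lemma cabs_expj x : cabs (expj x) = 1.
Proof. by rewrite /cabs /cnorm2 /= cos2Dsin2 sqrtr1. Qed.

End ComplexModulus.

(** * Sums over the integers and their tails *)

Section IntegerSums.
Variable R : realType.
Local Notation C := (R[i]).

(** Pairing [i] with [-(i+1)] visits every integer once and makes the partial sums of moduli
    literally the expression bounded in [abs_summable_Z]. *)
Definition psum (V : zmodType) (b : int -> V) (N : nat) : V :=
  \sum_(i < N) (b i%:Z + b (- (i.+1)%:Z)).

(* the symmetric window {-d, ..., d - 1} summed by psum *)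
Definition window (d : nat) (n : int) : bool := (- d%:Z <= n) && (n < d%:Z).
Definition tailZ (d : nat) (b : int -> R) (n : int) : R :=
  if window d n then 0 else b n.

Lemma psum_ge0 (b : int -> R) N : (forall n, 0 <= b n) -> 0 <= psum b N.
Proof. by move=> b0; apply: sumr_ge0 => i _; rewrite addr_ge0. Qed.

Lemma psum_nondecreasing (b : int -> R) : (forall n, 0 <= b n) ->
  {homo psum b : m n / (m <= n)%N >-> m <= n}.
Proof.
move=> b0; apply: homo_leq => // [? ? ?|n]; first exact: le_trans.
by rewrite /psum big_ord_recr /= lerDl addr_ge0.
Qed.

(** Row [i] of an N x N Toeplitz matrix meets the differences i, ..., 0, -1, ..., -(N-1-i), each
    once. *)
Lemma sum_shiftE (V : zmodType) (h : int -> V) (N i : nat) : (i < N)%N ->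
  \sum_(l < N) h (i%:Z - l%:Z) =
  \sum_(n < i.+1) h n%:Z + \sum_(n < N - i.+1) h (- n.+1%:Z).
Proof.
move=> iN; rewrite -(big_mkord xpredT (fun l => h (i%:Z - l%:Z))).
rewrite (big_cat_nat (n := i.+1))//=; congr (_ + _).
  rewrite big_nat_rev /= add0n big_mkord; apply: eq_bigr => l _.
  by congr h; have := ltn_ord l; lia.
rewrite -{1}(addn0 i.+1) addnC big_addn big_mkord; apply: eq_bigr => l _.
by congr h; lia.
Qed.

Lemma sum_ord_le (b : nat -> R) (m n : nat) : (forall k, 0 <= b k) ->
  (m <= n)%N -> \sum_(k < m) b k <= \sum_(k < n) b k.
Proof.
move=> b0 mn; rewrite (big_ord_widen_cond n xpredT b)// big_mkcond/=.
by apply: ler_sum => k _; case: ifP.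
Qed.

(** Bounds absolute row sums of Toeplitz matrices independently of the row and, for summable
    coefficients, of the size. *)
Lemma sum_shift_le (b : int -> R) (N i : nat) : (forall n, 0 <= b n) ->
  (i < N)%N -> \sum_(l < N) b (i%:Z - l%:Z) <= psum b N.
Proof.
move=> b0 iN; rewrite sum_shiftE// /psum big_split/=; apply: lerD.
  exact: (sum_ord_le (b := fun k => b k%:Z)).
by apply: (sum_ord_le (b := fun k => b (- k.+1%:Z))) => //; lia.
Qed.

(** A row at distance [d] from both ends sees the whole window, so its windowed sum does not depend
    on the row. *)
Lemma sum_shift_window (V : zmodType) (h : int -> V) (d N i : nat) :
  (d <= i)%N -> (i + d < N)%N ->
  \sum_(l < N) (if window d (i%:Z - l%:Z) then h (i%:Z - l%:Z) else 0) = psum h d.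
Proof.
move=> di idN; rewrite (sum_shiftE (fun n => if window d n then h n else 0)); last lia.
rewrite /psum big_split/=; congr (_ + _).
  rewrite [RHS](big_ord_widen_cond i.+1 xpredT (fun k => h k%:Z)); last lia.
  rewrite [RHS]big_mkcond; apply: eq_bigr => k _; rewrite /window.
  by have -> : ((- d%:Z <= k%:Z) && (k%:Z < d%:Z)) = (k < d)%N by lia.
rewrite [RHS](big_ord_widen_cond (N - i.+1) xpredT (fun k => h (- k.+1%:Z))); last lia.
rewrite [RHS]big_mkcond; apply: eq_bigr => k _; rewrite /window.
by have -> : ((- d%:Z <= - k.+1%:Z) && (- k.+1%:Z < d%:Z)) = (k < d)%N by lia.
Qed.

Lemma psum_window (V : zmodType) (b : int -> V) (d N : nat) : (d <= N)%N ->
  psum (fun n => if window d n then b n else 0) N = psum b d.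
Proof.
move=> dN; rewrite /psum [RHS](big_ord_widen_cond N xpredT
  (fun i => b i%:Z + b (- i.+1%:Z)))//.
rewrite [RHS]big_mkcond; apply: eq_bigr => i _; rewrite /window.
have -> : ((- d%:Z <= i%:Z) && (i%:Z < d%:Z)) = (i < d)%N by lia.
have -> : ((- d%:Z <= - i.+1%:Z) && (- i.+1%:Z < d%:Z)) = (i < d)%N by lia.
by case: ifP; rewrite ?addr0.
Qed.

Lemma psum_tail (b : int -> R) (d N : nat) : (d <= N)%N ->
  psum (tailZ d b) N = psum b N - psum b d.
Proof.
move=> dN; apply/eqP; rewrite eq_sym subr_eq -(psum_window b dN) /psum -big_split.
apply/eqP/eq_bigr => i _ /=; rewrite /tailZ.
by case: ifP; case: ifP; rewrite ?addr0 ?add0r// addrC.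
Qed.

Definition tail_le (a : int -> C) (d : nat) (e : R) :=
  forall N, psum (tailZ d (fun n => cabs (a n))) N <= e.

Lemma tailZ_ge0 d (b : int -> R) n : (forall n, 0 <= b n) -> 0 <= tailZ d b n.
Proof. by move=> b0; rewrite /tailZ; case: ifP. Qed.

Lemma summable_tail (a : int -> C) : abs_summable_Z a ->
  forall e : R, 0 < e -> exists d, tail_le a d e.
Proof.
move=> [M aM] e e0; pose b n := cabs (a n).
have b0 n : 0 <= b n by exact: cabs_ge0.
pose E := range (psum b).
have supE : has_sup E.
  split; first by exists (psum b 0); exists 0%N.
  by exists M => _ [N _ <-]; exact: aM.
have [_ [d _ <-] dE] := sup_adherent e0 supE.
exists d => N; apply: (@le_trans _ _ (psum (tailZ d b) (maxn d N))).
  by apply: psum_nondecreasing; [move=> n; exact: tailZ_ge0|exact: leq_maxr].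
rewrite psum_tail ?leq_maxl// lerBlDr addrC -lerBlDr; apply: le_trans (ltW dE).
by rewrite lerD2r; apply: sup_upper_bound => //; exists (maxn d N).
Qed.

Lemma tail_le_mono (a : int -> C) d d' e : (d <= d')%N -> tail_le a d e -> tail_le a d' e.
Proof.
move=> dd ade N; apply: le_trans (ade N); apply: ler_sum => i _.
have tail_mono m : tailZ d' (fun n => cabs (a n)) m <= tailZ d (fun n => cabs (a n)) m.
  rewrite /tailZ; case: ifP => wD; case: ifP => wd //; first exact: cabs_ge0.
  by move: wD wd; rewrite /window; lia.
exact: lerD.
Qed.

(** Domination by a complex sequence lets one lemma serve the real and the imaginary parts of
    [a]. *)
Lemma psum_cvg (b : int -> R) (a : int -> C) : abs_summable_Z a ->
  (forall n, `|b n| <= cabs (a n)) -> psum b @ \oo --> zsumR b.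
Proof.
move=> [M aM] ba.
have sumM (u : nat -> R) : (forall N : nat, \sum_(i < N) `|u i| <= M) ->
  cvgn (fun N : nat => \sum_(i < N) u i : R^o).
  move=> uM; rewrite (_ : (fun N => _) = series u); last first.
    by apply/funext => N; rewrite /series /= big_mkord.
  apply: normed_cvg; apply: nondecreasing_is_cvgn.
    by apply: nondecreasing_series => n _ _; exact: normr_ge0.
  by exists M => _ [N _ <-]; rewrite /normed_series_of /series /= big_mkord; exact: uM.
rewrite /zsumR (_ : psum b = (fun N : nat => \sum_(n < N) b n%:Z) \+
   (fun N : nat => \sum_(n < N) b (- n.+1%:Z))); last first.
  by apply/funext => N; rewrite /psum big_split.
have c1 : cvgn (fun N : nat => \sum_(n < N) b n%:Z).
  apply: (sumM (fun n => b n%:Z)) => N; apply: le_trans (aM N); apply: ler_sum => i _.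
  by rewrite (le_trans (ba _))// lerDl cabs_ge0.
have c2 : cvgn (fun N : nat => \sum_(n < N) b (- n.+1%:Z)).
  apply: (sumM (fun n => b (- n.+1%:Z))) => N; apply: le_trans (aM N).
  by apply: ler_sum => i _; rewrite (le_trans (ba _))// lerDr cabs_ge0.
exact: cvgD.
Qed.

Lemma zsumR_approx (b : int -> R) (a : int -> C) d e : abs_summable_Z a ->
  (forall n, `|b n| <= cabs (a n)) -> tail_le a d e ->
  `|zsumR b - psum b d| <= e.
Proof.
move=> sa ba ade; have cb := psum_cvg sa ba.
have cn : `|psum b N - psum b d| @[N --> \oo] --> `|zsumR b - psum b d|.
  by apply: cvg_norm; apply: cvgB => //; exact: cvg_cst.
rewrite -(cvg_lim _ cn)//; apply: limr_le; first by apply/cvg_ex; eexists; exact: cn.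
near=> N; have dN : (d <= N)%N by near: N; exists d.
apply: le_trans (ade N).
rewrite -(psum_window b dN) /psum -sumrB; apply: le_trans (ler_norm_sum _ _ _) _.
apply: ler_sum => i _; rewrite /tailZ opprD addrACA.
by apply: le_trans (ler_normD _ _) _; apply: lerD; case: ifP; rewrite ?subrr ?subr0 ?normr0.
Unshelve. all: by end_near. Qed.

Lemma Re_psum (a : int -> C) N : Re (psum a N) = psum (fun n => Re (a n)) N.
Proof. by rewrite /psum Re_sum; apply: eq_bigr => i _; rewrite RecD. Qed.
Lemma Im_psum (a : int -> C) N : Im (psum a N) = psum (fun n => Im (a n)) N.
Proof. by rewrite /psum Im_sum; apply: eq_bigr => i _; rewrite ImcD. Qed.

(** The factor 2 comes from estimating real and imaginary parts separately. *)
Lemma zsumC_approx (a : int -> C) d e : abs_summable_Z a -> tail_le a d e ->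
  cabs (zsumC a - psum a d) <= 2 * e.
Proof.
move=> sa ade; apply: le_trans (cabs_ReIm _) _.
rewrite RecB ImcB Re_psum Im_psum /= (_ : 2 * e = e + e); last by ring.
by apply: lerD; apply: (zsumR_approx sa) => // n; rewrite ?Re_cabs ?Im_cabs.
Qed.

Lemma abs_summable_eq_cabs (a b : int -> C) : (forall n, cabs (a n) = cabs (b n)) ->
  abs_summable_Z a -> abs_summable_Z b.
Proof.
move=> ab [M aM]; exists M => N; apply: le_trans (aM N).
by under eq_bigr do rewrite -!ab.
Qed.

Lemma tail_le_eq_cabs (a b : int -> C) d e : (forall n, cabs (a n) = cabs (b n)) ->
  tail_le a d e -> tail_le b d e.
Proof.
move=> ab ade N; apply: le_trans (ade N); apply: ler_sum => i _.
by rewrite /tailZ !ab.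
Qed.

Lemma zsumC_bound (a : int -> C) (M : R) : (forall N, psum (fun n => cabs (a n)) N <= M) ->
  cabs (zsumC a) <= 2 * M.
Proof.
move=> aM; have sa : abs_summable_Z a by exists M.
have : tail_le a 0 M.
  move=> N; rewrite psum_tail//; apply: le_trans (aM N).
  by rewrite /psum big_ord0 subr0.
by move/(zsumC_approx sa); rewrite /psum big_ord0 subr0.
Qed.

Lemma abs_summable0 : abs_summable_Z (fun _ : int => 0 : C).
Proof. by exists 0 => N; rewrite big1// => i _; rewrite cabs0 addr0. Qed.

Lemma zsumC0 : zsumC (fun _ : int => 0 : C) = 0.
Proof.
have h : forall N, psum (fun _ : int => cabs (0 : C)) N <= 0.
  by move=> N; rewrite /psum big1// => i _; rewrite cabs0 addr0.
apply: cabs_eq0; apply/eqP; rewrite eq_le cabs_ge0 andbT.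
by apply: le_trans (zsumC_bound h) _; rewrite mulr0.
Qed.

End IntegerSums.

(** * Complex integrals and orthogonality of the exponentials *)

Section ComplexIntegral.
Variable R : realType.
Local Notation C := (R[i]).
Local Notation mu := (@lebesgue_measure R).

Lemma measurable_Ihalf : measurable (Ihalf : set R).
Proof. exact: measurable_itv. Qed.
Hint Resolve measurable_Ihalf : core.

Lemma mu_Ihalf : mu (Ihalf : set R) = 1%E.
Proof.
rewrite /Defs.Ihalf lebesgue_measure_itv /= lte_fin ifT; last by lra.
by rewrite -EFinB; congr (_%:E); lra.
Qed.

(** Integrability does not pass to products. Bounded measurable functions are closed under products
    and are integrable on [Ihalf], which has measure 1. *)
Definition bmeasR (f : R -> R) := measurable_fun setT f /\ exists K : R, forall l, `|f l| <= K.

Lemma bmeasR_integrable f : bmeasR f -> mu.-integrable (Ihalf : set R) (EFin \o f).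
Proof.
move=> [mf [K fK]]; apply: measurable_bounded_integrable => //.
- by have h : (mu (Ihalf : set R) < +oo)%E; [rewrite mu_Ihalf ltry|exact: h].
- exact: measurable_funTS.
- exists K; split; first exact: num_real.
  by move=> M KM l _; apply: le_trans (fK l) _; exact: ltW.
Qed.

Lemma Rint_le_bound (f : R -> R) K : mu.-integrable (Ihalf : set R) (EFin \o f) ->
  (forall l, Ihalf l -> `|f l| <= K) -> `|Rint Ihalf f| <= K.
Proof.
move=> fi fK; apply: le_trans (le_normr_Rintegral _ fi) _ => //.
have -> : K = Rintegral mu (Ihalf : set R) (fun=> K).
  by rewrite Rintegral_cst// (_ : fine _ = 1) ?mulr1//; exact: (congr1 fine mu_Ihalf).
apply: le_Rintegral => //.
- exact: integrable_norm.
- by apply: bmeasR_integrable; split => //; exists `|K|.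
Qed.

Definition bmeas (f : R -> C) := [/\ measurable_fun setT (fun l => Re (f l)),
  measurable_fun setT (fun l => Im (f l)) & exists K, forall l, cabs (f l) <= K].

Lemma bmeas_Re f : bmeas f -> bmeasR (fun l => Re (f l)).
Proof.
by move=> [m1 _ [K fK]]; split => //; exists K => l; apply: le_trans (Re_cabs _) _.
Qed.

Lemma bmeas_Im f : bmeas f -> bmeasR (fun l => Im (f l)).
Proof.
by move=> [_ m1 [K fK]]; split => //; exists K => l; apply: le_trans (Im_cabs _) _.
Qed.

Lemma bmeas_cst c : bmeas (fun=> c).
Proof. by split; [exact: measurable_cst|exact: measurable_cst|exists (cabs c)]. Qed.

Lemma bmeasD f g : bmeas f -> bmeas g -> bmeas (fun l => f l + g l).
Proof.
move=> [f1 f2 [K fK]] [g1 g2 [L gL]]; split.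
- by under eq_fun do rewrite RecD; exact: measurable_funD.
- by under eq_fun do rewrite ImcD; exact: measurable_funD.
- by exists (K + L) => l; apply: le_trans (cabsD _ _) _; exact: lerD.
Qed.

Lemma bmeasM f g : bmeas f -> bmeas g -> bmeas (fun l => f l * g l).
Proof.
move=> [f1 f2 [K fK]] [g1 g2 [L gL]]; split.
- under eq_fun do rewrite RecM.
  by apply: measurable_funB; exact: measurable_funM.
- under eq_fun do rewrite ImcM.
  by apply: measurable_funD; exact: measurable_funM.
- by exists (K * L) => l; rewrite cabsM; apply: ler_pM; rewrite ?cabs_ge0.
Qed.

Lemma bmeas_sum I (r : seq I) (f : I -> R -> C) : (forall i, bmeas (f i)) ->
  bmeas (fun l => \sum_(i <- r) f i l).
Proof.
move=> mf; elim: r => [|i r IH].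
  by under eq_fun do rewrite big_nil; exact: bmeas_cst.
by under eq_fun do rewrite big_cons; exact: bmeasD.
Qed.

Lemma continuous_linear_comp (h : R -> R) (c : R) : continuous h ->
  continuous (fun l => h (c * l)).
Proof.
move=> ch l; apply: (@continuous_comp _ _ _ (fun l => c * l) h); last exact: ch.
exact: mulrl_continuous.
Qed.

Lemma bmeas_expj c : bmeas (fun l => expj (c * l)).
Proof.
split => /=; last by exists 1 => l; rewrite cabs_expj.
- by apply: continuous_measurable_fun; apply: continuous_linear_comp; exact: continuous_cos.
- by apply: continuous_measurable_fun; apply: continuous_linear_comp; exact: continuous_sin.
Qed.

Definition cintegrable (D : set R) (f : R -> C) :=
  mu.-integrable D (EFin \o (fun l => Re (f l))) /\
  mu.-integrable D (EFin \o (fun l => Im (f l))).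

Definition cintegral (D : set R) (f : R -> C) : C :=
  Complex (Rint D (fun l => Re (f l))) (Rint D (fun l => Im (f l))).

Lemma eq_cintegral D f g : (forall l, f l = g l) -> cintegral D f = cintegral D g.
Proof. by move=> fg; congr cintegral; apply/funext. Qed.

Section Linearity.
Variables (D : set R) (mD : measurable D).

Lemma integrable_addr (f g : R -> R) : mu.-integrable D (EFin \o f) ->
  mu.-integrable D (EFin \o g) -> mu.-integrable D (EFin \o (fun l => f l + g l)).
Proof.
move=> fi gi; rewrite (_ : _ \o _ = ((EFin \o f) \+ (EFin \o g))%E); last by apply/funext.
exact: integrableD.
Qed.

Lemma integrable_mulrl (r : R) (h : R -> R) : mu.-integrable D (EFin \o h) ->
  mu.-integrable D (EFin \o (fun l => r * h l)).
Proof.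
move=> ih; rewrite (_ : _ \o _ = (fun x => r%:E * (EFin \o h) x)%E); last by apply/funext.
exact: integrableZl.
Qed.

Lemma integrable_subr (f g : R -> R) : mu.-integrable D (EFin \o f) ->
  mu.-integrable D (EFin \o g) -> mu.-integrable D (EFin \o (fun l => f l - g l)).
Proof.
move=> fi /(integrable_mulrl (-1)) gi.
rewrite (_ : (fun l => _) = fun l => f l + -1 * g l); first exact: integrable_addr.
by apply/funext => l; rewrite mulN1r.
Qed.

Lemma cintegrableD f g : cintegrable D f -> cintegrable D g ->
  cintegrable D (fun l => f l + g l).
Proof.
move=> [f1 f2] [g1 g2]; split; first by under eq_fun do rewrite RecD; exact: integrable_addr.
by under eq_fun do rewrite ImcD; exact: integrable_addr.
Qed.

Lemma cintegrableZ c f : cintegrable D f -> cintegrable D (fun l => c * f l).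
Proof.
move=> [f1 f2]; split; under eq_fun do rewrite ?RecM ?ImcM.
  by apply: integrable_subr; exact: integrable_mulrl.
by apply: integrable_addr; exact: integrable_mulrl.
Qed.

Lemma cintegrable0 : cintegrable D (fun=> 0).
Proof. by split; exact: integrable0. Qed.

Lemma cintegrable_sum I (r : seq I) (f : I -> R -> C) : (forall i, cintegrable D (f i)) ->
  cintegrable D (fun l => \sum_(i <- r) f i l).
Proof.
move=> mf; elim: r => [|i r IH].
  by under eq_fun do rewrite big_nil; exact: cintegrable0.
by under eq_fun do rewrite big_cons; exact: cintegrableD.
Qed.

Lemma cintegralD f g : cintegrable D f -> cintegrable D g ->
  cintegral D (fun l => f l + g l) = cintegral D f + cintegral D g.
Proof.
move=> [f1 f2] [g1 g2]; apply: complex_ext; rewrite ?RecD ?ImcD /= /Defs.Rint -RintegralD//.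
- by apply: eq_Rintegral => l _; rewrite RecD.
- by apply: eq_Rintegral => l _; rewrite ImcD.
Qed.

Lemma cintegralZ c f : cintegrable D f -> cintegral D (fun l => c * f l) = c * cintegral D f.
Proof.
move=> [f1 f2]; apply: complex_ext; rewrite ?RecM ?ImcM /= /Defs.Rint -!RintegralZl//.
- rewrite -RintegralB//; do ?exact: integrable_mulrl.
  by apply: eq_Rintegral => l _; rewrite RecM.
- rewrite -RintegralD//; do ?exact: integrable_mulrl.
  by apply: eq_Rintegral => l _; rewrite ImcM.
Qed.

Lemma cintegral0 : cintegral D (fun=> 0) = 0.
Proof. by apply: complex_ext; rewrite /= /Defs.Rint Rintegral_cst// mul0r. Qed.

Lemma cintegral_sum I (r : seq I) (f : I -> R -> C) : (forall i, cintegrable D (f i)) ->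
  cintegral D (fun l => \sum_(i <- r) f i l) = \sum_(i <- r) cintegral D (f i).
Proof.
move=> mf; elim: r => [|i r IH].
  by rewrite big_nil -[RHS]cintegral0; apply: eq_cintegral => l; rewrite big_nil.
rewrite big_cons -IH -cintegralD//; last exact: cintegrable_sum.
by apply: eq_cintegral => l; rewrite big_cons.
Qed.

End Linearity.

Definition cint : (R -> C) -> C := cintegral Ihalf.

Lemma bmeas_cintegrable f : bmeas f -> cintegrable Ihalf f.
Proof.
by move=> mf; split; apply: bmeasR_integrable; [exact: bmeas_Re|exact: bmeas_Im].
Qed.

Lemma eq_cint f g : (forall l, f l = g l) -> cint f = cint g.
Proof. exact: eq_cintegral. Qed.

Lemma cintD f g : bmeas f -> bmeas g ->
  cint (fun l => f l + g l) = cint f + cint g.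
Proof. by move=> mf mg; apply: cintegralD => //; exact: bmeas_cintegrable. Qed.

Lemma cintZ c f : bmeas f -> cint (fun l => c * f l) = c * cint f.
Proof. by move=> mf; apply: cintegralZ => //; exact: bmeas_cintegrable. Qed.

Lemma cint_sum I (r : seq I) (f : I -> R -> C) : (forall i, bmeas (f i)) ->
  cint (fun l => \sum_(i <- r) f i l) = \sum_(i <- r) cint (f i).
Proof. by move=> mf; apply: cintegral_sum => // i; exact: bmeas_cintegrable. Qed.

Lemma cint_le_bound f K : bmeas f -> (forall l, cabs (f l) <= K) ->
  cabs (cint f) <= 2 * K.
Proof.
move=> mf fK; apply: le_trans (cabs_ReIm _) _; rewrite (_ : 2 * K = K + K); last by ring.
apply: lerD; apply: Rint_le_bound.
- by apply: bmeasR_integrable; exact: bmeas_Re.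
- by move=> l _; exact: le_trans (Re_cabs _) _.
- by apply: bmeasR_integrable; exact: bmeas_Im.
- by move=> l _; exact: le_trans (Im_cabs _) _.
Qed.

Lemma Rint_FTC (f F : R -> R) : continuous f -> (forall x : R, is_derive x (1 : R) F (f x)) ->
  Rint Ihalf f = F (1 / 2) - F (- (1 / 2)).
Proof.
move=> cf dF.
have cF : continuous F.
  by move=> x; apply/differentiable_continuous/derivable1_diffP; have [] := dF x.
rewrite /Defs.Rint /Rintegral (@continuous_FTC2 _ f F)//.
- by lra.
- exact: continuous_subspaceT.
- split; first by move=> x _; have [] := dF x.
  + by apply: cvg_at_right_filter; exact: cF.
  + by apply: cvg_at_left_filter; exact: cF.
- by move=> x _; rewrite derive1E; apply: derive_val.
Qed.

Lemma expj_pi_int (n : int) : expj (2 * pi * n%:~R) = 1 :> C.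
Proof.
have hn (m : nat) : expj (2 * pi * m%:R) = 1 :> C.
  elim: m => [|m IH]; first by rewrite mulr0 expj0.
  rewrite -[m.+1%:R]natr1 mulrDr mulr1 expjD IH mul1r.
  by apply: complex_ext => /=; rewrite mulrC mulr_natr ?cos2pi ?sin2pi.
case: n => m; first exact: hn.
rewrite NegzE mulrNz mulrN expjN (hn m.+1); apply: complex_ext => //=.
by rewrite oppr0.
Qed.

(** For [n != 0] the antiderivatives of cosine and sine have period 1, so their values at the two
    endpoints cancel. *)
Lemma cint_expj (n : int) : cint (fun l => expj (2 * pi * n%:~R * l)) = (n == 0)%:R.
Proof.
have [->|n0] := eqVneq n 0.
  rewrite /=; apply: complex_ext => /=.
    rewrite (_ : (fun l => _) = fun=> 1); last first.
      by apply/funext => l; rewrite mulr0 mul0r cos0.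
    by rewrite /Defs.Rint Rintegral_cst// (_ : fine _ = 1) ?mulr1//; exact: (congr1 fine mu_Ihalf).
  rewrite (_ : (fun l => _) = fun=> 0); last first.
    by apply/funext => l; rewrite mulr0 mul0r sin0.
  by rewrite /Defs.Rint Rintegral_cst// mul0r.
set c := 2 * pi * n%:~R.
have c0 : c != 0.
  by rewrite /c !mulf_neq0 ?intr_eq0// ?pnatr_eq0// lt0r_neq0// pi_gt0.
have per : expj (c * (1 / 2)) = expj (c * (- (1 / 2))).
  have -> : c * (1 / 2) = c * (- (1 / 2)) + c by field.
  by rewrite expjD expj_pi_int mulr1.
have dl (x : R) : is_derive x (1 : R) (fun x : R => c * x) c.
  by rewrite -[X in is_derive _ _ _ X]mulr1; exact: is_deriveZ.
have ds (x : R) : is_derive x (1 : R) (fun x => c^-1 * sin (c * x)) (cos (c * x)).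
  rewrite (_ : cos _ = c^-1 * (cos (c * x) * c)); last by field.
  by apply: is_deriveZ; exact: (is_derive1_comp (f := sin) (g := fun x => c * x)).
have dc (x : R) : is_derive x (1 : R) (fun x => - c^-1 * cos (c * x)) (sin (c * x)).
  rewrite (_ : sin _ = - c^-1 * (- sin (c * x) * c)); last by field.
  by apply: is_deriveZ; exact: (is_derive1_comp (f := cos) (g := fun x => c * x)).
apply: complex_ext => /=.
  rewrite (Rint_FTC _ ds); last first.
    by apply: continuous_linear_comp; exact: continuous_cos.
  by move: per => [_ ->]; rewrite subrr.
rewrite (Rint_FTC _ dc); last first.
  by apply: continuous_linear_comp; exact: continuous_sin.
by move: per => [-> _]; rewrite subrr.
Qed.

End ComplexIntegral.

(** * Fourier series with absolutely summable coefficients *)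

Section Symbols.
Variable R : realType.
Local Notation C := (R[i]).

(** The sign of the exponent is that of [Gdelta] and [G12delta], which thereby become instances;
    [fourier_coef] carries the opposite sign. *)
Definition symb (a : int -> C) (l : R) : C :=
  zsumC (fun n => a n * expj (2 * pi * l * n%:~R)).

Definition fourier_coef (n : int) (f : R -> C) : C :=
  cint (fun l => f l * expj (- (2 * pi * l * n%:~R))).

Lemma bmeas_expjZ (n : int) : bmeas (fun l : R => expj (2 * pi * l * n%:~R)).
Proof.
rewrite (_ : (fun l => _) = fun l => expj (2 * pi * n%:~R * l)); last first.
  by apply/funext => l; rewrite mulrAC.
exact: bmeas_expj.
Qed.

Lemma bmeas_expjNZ (n : int) : bmeas (fun l : R => expj (- (2 * pi * l * n%:~R))).
Proof.
rewrite (_ : (fun l => _) = fun l => expj (2 * pi * l * (- n)%:~R)); last first.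
  by apply/funext => l; rewrite mulrNz mulrN.
exact: bmeas_expjZ.
Qed.

Lemma cabs_mul_expj (a : int -> C) (l : R) n :
  cabs (a n) = cabs (a n * expj (2 * pi * l * n%:~R)).
Proof. by rewrite cabsM cabs_expj mulr1. Qed.

Definition psymb (a : int -> C) (d : nat) (l : R) : C :=
  psum (fun n => a n * expj (2 * pi * l * n%:~R)) d.

Lemma bmeas_psymb a d : bmeas (psymb a d).
Proof.
apply: bmeas_sum => i; apply: bmeasD; apply: bmeasM;
  by [exact: bmeas_cst|exact: bmeas_expjZ].
Qed.

Lemma symb_approx a d e l : abs_summable_Z a -> tail_le a d e ->
  cabs (symb a l - psymb a d l) <= 2 * e.
Proof.
move=> sa ade; apply: zsumC_approx.
  exact: (abs_summable_eq_cabs (cabs_mul_expj a l)).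
exact: (tail_le_eq_cabs (cabs_mul_expj a l)).
Qed.

Lemma symb_bound a (M : R) l : (forall N, psum (fun n => cabs (a n)) N <= M) ->
  cabs (symb a l) <= 2 * M.
Proof.
move=> aM; apply: zsumC_bound => N; apply: le_trans (aM N).
by apply: ler_sum => i _; rewrite -!cabs_mul_expj.
Qed.

(** Measurability comes from pointwise convergence of the trigonometric partial sums. *)
Lemma bmeas_symb a : abs_summable_Z a -> bmeas (symb a).
Proof.
move=> sa; have [M aM] := sa.
split; last by exists (2 * M) => l; exact: symb_bound.
- apply: (@measurable_fun_cvg _ _ _ _ (fun N l => Re (psymb a N l))).
    by move=> N; have [] := bmeas_psymb a N.
  move=> l _; rewrite (_ : (fun N => _) = psum (fun n => Re (a n * expj (2 * pi * l * n%:~R)))).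
    apply: psum_cvg; first exact: (abs_summable_eq_cabs (cabs_mul_expj a l)).
    by move=> n; exact: Re_cabs.
  by apply/funext => N; rewrite /psymb Re_psum.
- apply: (@measurable_fun_cvg _ _ _ _ (fun N l => Im (psymb a N l))).
    by move=> N; have [] := bmeas_psymb a N.
  move=> l _; rewrite (_ : (fun N => _) = psum (fun n => Im (a n * expj (2 * pi * l * n%:~R)))).
    apply: psum_cvg; first exact: (abs_summable_eq_cabs (cabs_mul_expj a l)).
    by move=> n; exact: Im_cabs.
  by apply/funext => N; rewrite /psymb Im_psum.
Qed.

(** Multiplication by the exponential of frequency [k] shifts Fourier coefficients by [k]; this
    gives a finite convolution. *)
Lemma fourier_coef_psymb a d n f : bmeas f ->
  fourier_coef n (fun l => psymb a d l * f l) =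
  psum (fun k => a k * fourier_coef (n - k) f) d.
Proof.
move=> mf.
have mk k : bmeas (fun l => f l * expj (- (2 * pi * l * k%:~R))).
  by apply: bmeasM => //; exact: bmeas_expjNZ.
have mak k : bmeas (fun l => a k * (f l * expj (- (2 * pi * l * (n - k)%:~R)))).
  by apply: bmeasM => //; exact: bmeas_cst.
rewrite /psum /fourier_coef; under [RHS]eq_bigr do rewrite -!cintZ// -cintD//.
rewrite -cint_sum; last by move=> i; exact: bmeasD.
apply: eq_cint => l; rewrite /psymb /psum !mulr_suml; apply: eq_bigr => i _.
rewrite !mulrDl; congr (_ + _); rewrite -!mulrA; congr (_ * _); rewrite mulrCA;
  by rewrite -expjD; congr (_ * expj _); rewrite !rmorphB /=; ring.
Qed.

(** The convolution formula with only finitely many coefficients of [a]. The constant 4 is a factor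
    2 from [symb_approx] times a factor 2 from [cint_le_bound]. *)
Lemma fourier_coef_symb_approx a d e n f K : abs_summable_Z a -> tail_le a d e ->
  bmeas f -> (forall l, cabs (f l) <= K) ->
  cabs (fourier_coef n (fun l => symb a l * f l) -
        psum (fun k => a k * fourier_coef (n - k) f) d) <= 4 * e * K.
Proof.
move=> sa ade mf fK.
have ms := bmeas_symb sa; have mp := bmeas_psymb a d; have me := bmeas_expjNZ n.
have m1 : bmeas (fun l => -1 * (psymb a d l * f l * expj (- (2 * pi * l * n%:~R)))).
  by apply: bmeasM; [exact: bmeas_cst|apply: bmeasM => //; exact: bmeasM].
rewrite -fourier_coef_psymb// /fourier_coef -mulN1r -cintZ; last first.
  by apply: bmeasM => //; exact: bmeasM.
rewrite -cintD//; last by apply: bmeasM => //; exact: bmeasM.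
rewrite (_ : 4 * e * K = 2 * (2 * e * K)); last by ring.
apply: cint_le_bound; first by apply: bmeasD => //; apply: bmeasM => //; exact: bmeasM.
move=> l; rewrite mulN1r -!mulrA -mulrBl !cabsM cabs_expj mulr1 mulrA.
by apply: ler_pM; rewrite ?cabs_ge0//; exact: symb_approx.
Qed.

Lemma fourier_coef_cst n c : fourier_coef n (fun=> c) = c * (n == 0)%:R.
Proof.
rewrite /fourier_coef cintZ; last exact: bmeas_expjNZ.
rewrite -oppr_eq0 -cint_expj; congr (_ * _); apply: eq_cint => l.
by congr expj; rewrite mulrNz; ring.
Qed.

Lemma fourier_coef_symb a n : abs_summable_Z a -> fourier_coef n (symb a) = a n.
Proof.
move=> sa; apply/eqP; rewrite -subr_eq0; apply/eqP/cabs_eq0/eqP.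
rewrite eq_le cabs_ge0 andbT; apply/ler_addgt0Pr => e e0; rewrite add0r.
have [d ade] := summable_tail sa (divr_gt0 e0 (ltr0n _ 4)).
(* The window must contain [n] besides leaving a tail of mass at most [e / 4]. *)
pose D := maxn d (absz n).+1.
have aDe : tail_le a D (e / 4) by apply: tail_le_mono ade; exact: leq_maxl.
have := fourier_coef_symb_approx n sa aDe (bmeas_cst 1) (K := 1).
rewrite (_ : 4 * (e / 4) * 1 = e); last by field.
under [X in fourier_coef n X]eq_fun do rewrite mulr1.
move=> /(_ (fun l => _)) H; apply: le_trans (H _); last by rewrite cabs1.
have -> // : psum (fun k => a k * fourier_coef (n - k) (fun=> 1)) D = a n.
under [X in psum X]eq_fun do rewrite fourier_coef_cst mul1r subr_eq0.
(* [n] occurs in exactly one summand of [psum], as its first or as its second term. *)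
have [m mD nm] : exists2 m, (m < D)%N & n = m%:Z \/ n = - m.+1%:Z.
  by exists (if (0 <= n)%R then absz n else (absz n).-1); rewrite /D; case: ifP; lia.
rewrite /psum (bigD1 (Ordinal mD))//= big1 ?addr0; last first.
  move=> i; rewrite -(inj_eq val_inj) /= => im.
  have [-> ->] : (n == i%:Z) = false /\ (n == - i.+1%:Z) = false by lia.
  by rewrite !mulr0 addr0.
case: nm => ->; first by rewrite eqxx (_ : _ == _ = false); [rewrite mulr1 mulr0 addr0|lia].
by rewrite eqxx (_ : _ == m%:Z = false); [rewrite mulr1 mulr0 add0r|lia].
Qed.

End Symbols.

(** * Block Toeplitz matrices and asymptotic symbols of their products *)

Section BlockToeplitz.
Variable R : realType.
Local Notation C := (R[i]).

(** Indexing by pairs [(u, i)] of block and time treats all four blocks by one formula. *)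
Definition blk (N : nat) (u : 'I_2) (i : 'I_N) : 'I_(N + N) :=
  if u == 0 then lshift N i else rshift N i.

Lemma ord2P (u : 'I_2) : (u = 0) + (u = 1).
Proof. by case: u => -[|[|//]] h; [left|right]; exact/val_inj. Qed.

Lemma sum_blk (V : zmodType) (N : nat) (F : 'I_(N + N) -> V) :
  \sum_p F p = \sum_(u < 2) \sum_(i < N) F (blk u i).
Proof. by rewrite big_split_ord /= big_ord_recl big_ord1. Qed.

Lemma blk_exists N (p : 'I_(N + N)) : exists u i, p = blk u i.
Proof.
rewrite -(splitK p); case: (fintype.split p) => i /=; first by exists 0, i.
by exists 1, i.
Qed.

Lemma blk_eq N (u v : 'I_2) (i j : 'I_N) : (blk u i == blk v j) = (u == v) && (i == j).
Proof.
rewrite /blk; case: (ord2P u) => ->; case: (ord2P v) => -> /=;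
  by rewrite ?eq_lshift ?eq_rshift ?eq_lrshift ?eq_rlshift ?eqxx.
Qed.

Definition btoep (a : 'I_2 -> 'I_2 -> int -> C) (N : nat) : 'M[C]_(N + N) :=
  let T u v := \matrix_(i < N, j < N) a u v (i%:Z - j%:Z) in
  block_mx (T 0 0) (T 0 1) (T 1 0) (T 1 1).

Lemma btoepE a N u v (i j : 'I_N) :
  btoep a N (blk u i) (blk v j) = a u v (i%:Z - j%:Z).
Proof.
rewrite /btoep /blk; case: (ord2P u) => ->; case: (ord2P v) => -> /=;
  by rewrite ?block_mxEul ?block_mxEur ?block_mxEdl ?block_mxEdr mxE.
Qed.

Definition bsymb (a : 'I_2 -> 'I_2 -> int -> C) (l : R) : 'M[C]_2 :=
  \matrix_(u, v) symb (a u v) l.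

(** [M N] need not be Toeplitz; it only looks so in rows far from both ends, uniformly in the
    column. Restricting the row index alone makes the property stable under left multiplication by a
    Toeplitz matrix, whose row [i] weights mostly the rows of [M] near [i]. The entry bound [K]
    controls the remaining rows. *)
Definition asymp_symbol (F : R -> 'M[C]_2) (M : forall N, 'M[C]_(N + N)) :=
  [/\ forall u v, bmeas (fun l => F l u v),
      exists K, forall N p q, cabs (M N p q) <= K &
      forall e, 0 < e -> exists D : nat, forall N u v (i j : 'I_N),
        (D <= i)%N -> (i + D < N)%N ->
        cabs (M N (blk u i) (blk v j) - fourier_coef (i%:Z - j%:Z) (fun l => F l u v)) <= e].

Lemma asymp_symbol1 : asymp_symbol (fun=> 1%:M) (fun N => 1%:M).
Proof.
split; first by move=> u v; exact: bmeas_cst.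
  exists 1 => N p q; rewrite mxE; case: eqP => _; rewrite ?cabs1 ?cabs0//.
move=> e e0; exists 0%N => N u v i j _ _; rewrite fourier_coef_cst !mxE blk_eq subr_eq0.
by rewrite eqz_nat (inj_eq val_inj); case: eqP; case: eqP; rewrite ?mulr1 ?mulr0 subrr cabs0 ltW.
Qed.

(** Inside the window [x] is replaced by [y] with error [e1] against the total mass [A] of [a];
    outside only the bound [K] on [x] is known, but there [a] has mass at most [e2]. *)
Lemma sum_window_tail_le (a : int -> C) (d N : nat) (i : 'I_N) (x y : 'I_N -> C) (A e1 e2 K : R) :
  (forall n, psum (fun n => cabs (a n)) n <= A) -> tail_le a d e2 -> 0 <= e1 -> 0 <= K ->
  (forall l : 'I_N, window d (i%:Z - l%:Z) -> cabs (x l - y l) <= e1) ->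
  (forall l, cabs (x l) <= K) ->
  cabs (\sum_(l < N) a (i%:Z - l%:Z) * x l -
        \sum_(l < N) (if window d (i%:Z - l%:Z) then a (i%:Z - l%:Z) * y l else 0))
  <= A * e1 + e2 * K.
Proof.
move=> aA ade e10 K0 xy xK; rewrite -sumrB; apply: le_trans (cabs_sum _ _ _) _.
pose b1 n := cabs (a n); pose b2 := tailZ d b1.
have b10 n : 0 <= b1 n by exact: cabs_ge0.
have b20 n : 0 <= b2 n by exact: tailZ_ge0.
apply: (@le_trans _ _ (\sum_(l < N) (b1 (i%:Z - l%:Z) * e1 + b2 (i%:Z - l%:Z) * K))).
  apply: ler_sum => l _; rewrite /b2 /tailZ; case: ifPn => w.
    by rewrite mul0r addr0 -mulrBr cabsM ler_wpM2l ?cabs_ge0// xy.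
  rewrite subr0 cabsM ler_wpDl ?mulr_ge0//.
  by rewrite ler_wpM2l ?cabs_ge0.
rewrite big_split /= -!mulr_suml; apply: lerD; apply: ler_wpM2r => //.
  by apply: le_trans (sum_shift_le _ _) (aA N).
by apply: le_trans (sum_shift_le _ _) (ade N).
Qed.

(** Row [i] of the product combines rows [i - n] of [M] with weights [a n]. For [n] in a window
    these rows are deep again and give the truncated convolution of [fourier_coef_symb_approx]; the
    other [n] carry little mass. *)
Lemma asymp_symbolM a F M : (forall u v, abs_summable_Z (a u v)) ->
  asymp_symbol F M -> asymp_symbol (fun l => bsymb a l *m F l) (fun N => btoep a N *m M N).
Proof.
move=> sa [mF [K0 MK0] hF].
have [A aA] : exists A, forall u v N, psum (fun n => cabs (a u v n)) N <= A.
  have /choice[A1 hA1] : forall uv : 'I_2 * 'I_2, exists A, forall N,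
    psum (fun n => cabs (a uv.1 uv.2 n)) N <= A by move=> [u v]; exact: sa.
  exists (\sum_uv `|A1 uv|) => u v N; apply: le_trans (hA1 (u, v) N) _.
  by rewrite (bigD1 (u, v))//=; apply: le_trans (ler_norm _) _; rewrite lerDl sumr_ge0.
have A0 : 0 <= A by apply: le_trans (aA 0 0 0%N); apply: psum_ge0 => n; exact: cabs_ge0.
pose K := `|K0|.
have K0' : 0 <= K by exact: normr_ge0.
have MK N p q : cabs (M N p q) <= K by apply: le_trans (MK0 N p q) (ler_norm _).
have [L FL] : exists L, forall u v l, cabs (F l u v) <= L.
  have /choice[A1 hA1] : forall uv : 'I_2 * 'I_2, exists A, forall l,
    cabs (F l uv.1 uv.2) <= A by move=> [u v]; have [] := mF u v.
  exists (\sum_uv `|A1 uv|) => u v l; apply: le_trans (hA1 (u, v) l) _.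
  by rewrite (bigD1 (u, v))//=; apply: le_trans (ler_norm _) _; rewrite lerDl sumr_ge0.
have L0 : 0 <= L by apply: le_trans (FL 0 0 0); exact: cabs_ge0.
have prodE u v l : (bsymb a l *m F l) u v = \sum_w symb (a u w) l * F l w v.
  by rewrite mxE; apply: eq_bigr => w _; rewrite mxE.
have mprod u v w : bmeas (fun l => symb (a u w) l * F l w v).
  by apply: bmeasM => //; exact: bmeas_symb.
split.
- move=> u v; under eq_fun do rewrite prodE.
  exact: bmeas_sum.
- exists (2 * (A * K)) => N p q; have [u [i ->]] := blk_exists p.
  rewrite mxE sum_blk; apply: le_trans (cabs_sum _ _ _) _.
  apply: (@le_trans _ _ (\sum_(w < 2) A * K)); last first.
    by rewrite sumr_const card_ord mulr_natl.
  apply: ler_sum => w _; apply: le_trans (cabs_sum _ _ _) _.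
  under eq_bigr do rewrite btoepE cabsM.
  apply: (@le_trans _ _ (\sum_(l < N) cabs (a u w (i%:Z - l%:Z)) * K)).
    by apply: ler_sum => l _; rewrite ler_wpM2l ?cabs_ge0.
  rewrite -mulr_suml ler_wpM2r//; apply: le_trans (aA u w N).
  by apply: (sum_shift_le (b := fun n => cabs (a u w n))) => // n; exact: cabs_ge0.
move=> e e0.
(* Each of the two intermediate blocks [w] may cost [e / 2]: [A * e1 <= e / 4] for the entries in
   the window, and [e2 * (K + 4 * L) <= e / 4] for the two truncations. The summand 1 keeps the
   denominators positive. *)
pose e1 := e / (4 * (A + 1)); pose e2 := e / (4 * (K + 4 * L + 1)).
have e10 : 0 < e1 by rewrite /e1 divr_gt0//; lra.
have e20 : 0 < e2 by rewrite /e2 divr_gt0//; lra.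
have [D1 hD1] := hF e1 e10.
have [d hd] : exists d, forall u v, tail_le (a u v) d e2.
  have /choice[A1 hA1] : forall uv : 'I_2 * 'I_2, exists d, tail_le (a uv.1 uv.2) d e2.
    by move=> [u v]; exact: summable_tail.
  exists (\max_uv A1 uv) => u v; apply: tail_le_mono (hA1 (u, v)).
  exact: (leq_bigmax (u, v)).
(* At this depth every row within the window of row [i] still has depth [D1]. *)
exists (D1 + d)%N => N u v i j Di iDN.
rewrite (_ : fourier_coef _ _ = \sum_(w < 2) fourier_coef (i%:Z - j%:Z)
   (fun l => symb (a u w) l * F l w v)); last first.
  rewrite /fourier_coef -cint_sum; last first.
    by move=> w; apply: bmeasM => //; exact: bmeas_expjNZ.
  by apply: eq_cint => l; rewrite prodE mulr_suml.
rewrite mxE sum_blk -sumrB; apply: le_trans (cabs_sum _ _ _) _.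
apply: (@le_trans _ _ (\sum_(w < 2) (e / 2))); last first.
  by rewrite sumr_const card_ord -mulr_natl; lra.
apply: ler_sum => w _; under eq_bigr do rewrite btoepE.
set f := fun l => F l w v.
have H1 := fourier_coef_symb_approx (i%:Z - j%:Z) (sa u w) (hd u w) (mF w v) (FL w v).
have H2 : cabs (\sum_(l < N) a u w (i%:Z - l%:Z) * M N (blk w l) (blk v j) -
   psum (fun k => a u w k * fourier_coef (i%:Z - j%:Z - k) f) d) <= A * e1 + e2 * K.
  rewrite -(@sum_shift_window _ _ d N i); [|lia|lia].
  have shiftE (l : 'I_N) : i%:Z - j%:Z - (i%:Z - l%:Z) = l%:Z - j%:Z by lia.
  under [X in _ - X]eq_bigr do rewrite shiftE.
  apply: sum_window_tail_le => //; first exact: ltW.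
  move=> l; rewrite /window => wl; apply: hD1; lia.
rewrite -(subrKA (psum (fun k => a u w k * fourier_coef (i%:Z - j%:Z - k) f) d)).
apply: le_trans (cabsD _ _) _; apply: le_trans (lerD H2 _) _.
  by rewrite -cabsN opprB; exact: H1.
have frac (B : R) : 0 <= B -> e / (4 * (B + 1)) * B <= e / 4.
  move=> B0; have -> : e / (4 * (B + 1)) * B = e / 4 * (B / (B + 1)) by field; lra.
  by rewrite ler_piMr ?ler_pdivrMr; lra.
have E1 := frac A A0.
have E2 : e2 * (K + 4 * L) <= e / 4 by apply: frac; lra.
rewrite -/e1 in E1.
lra.
Qed.

End BlockToeplitz.

(** * Normalized traces and Fejér means *)

Section Averages.
Variable R : realType.
Local Notation C := (R[i]).

Definition cvgC (x : nat -> C) (c : C) :=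
  forall e, 0 < e -> exists N0, forall N, (N0 <= N)%N -> cabs (x N - c) <= e.

Lemma cvgC_cst c : cvgC (fun=> c) c.
Proof. by move=> e e0; exists 0%N => N _; rewrite subrr cabs0 ltW. Qed.

Lemma cvgCD x y c d : cvgC x c -> cvgC y d -> cvgC (fun N => x N + y N) (c + d).
Proof.
move=> xc yd e e0; have e20 : 0 < e / 2 by lra.
have [N1 h1] := xc _ e20; have [N2 h2] := yd _ e20.
exists (maxn N1 N2) => N; rewrite geq_max => /andP[n1 n2].
rewrite opprD addrACA; apply: le_trans (cabsD _ _) _.
by have := h1 N n1; have := h2 N n2; lra.
Qed.

Lemma cvgCZ k x c : cvgC x c -> cvgC (fun N => k * x N) (k * c).
Proof.
move=> xc e e0; have k0 := cabs_ge0 k.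
have [|N0 h] := xc (e / (cabs k + 1)); first by rewrite divr_gt0//; lra.
exists N0 => N /h xN; rewrite -mulrBr cabsM.
apply: (@le_trans _ _ (cabs k * (e / (cabs k + 1)))); first by rewrite ler_wpM2l.
by rewrite mulrA ler_pdivrMr; nra.
Qed.

Lemma cvgC_sum I (r : seq I) (x : I -> nat -> C) (c : I -> C) :
  (forall i, cvgC (x i) (c i)) -> cvgC (fun N => \sum_(i <- r) x i N) (\sum_(i <- r) c i).
Proof.
move=> xc; elim: r => [|i r IH].
  by under eq_fun do rewrite big_nil; rewrite big_nil; exact: cvgC_cst.
by under eq_fun do rewrite big_cons; rewrite big_cons; exact: cvgCD.
Qed.

Lemma eq_cvgC x y c : (forall N, x N = y N) -> cvgC x c -> cvgC y c.
Proof. by move=> xy xc e /xc[N0 h]; exists N0 => N /h; rewrite xy. Qed.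

(** In the order of [R[i]], nonnegativity includes reality, so the imaginary part has to be shown to
    vanish in the limit as well. *)
Lemma cvgC_ge0 x c : (forall N, 0 <= x N) -> cvgC x c -> 0 <= c.
Proof.
move=> x0 xc; rewrite lecE /=; apply/andP; split.
  rewrite -normr_le0; apply/ler_addgt0Pr => e e0; rewrite add0r.
  have [N0 /(_ N0 (leqnn _)) h] := xc e e0.
  apply: le_trans h; apply: le_trans (Im_cabs _); rewrite ImcB.
  by have := x0 N0; rewrite lecE /= => /andP[/eqP -> _]; rewrite sub0r normrN.
apply/ler_addgt0Pr => e e0; have [N0 /(_ N0 (leqnn _)) h] := xc e e0.
have := x0 N0; rewrite lecE /= => /andP[_ xN].
have := le_trans (Re_cabs _) h; rewrite RecB ler_norml => /andP[h1 h2].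
lra.
Qed.

Lemma sum_lt_le (N D : nat) : (\sum_(i < N) (i < D)%N <= D)%N.
Proof.
suff -> : (\sum_(i < N) (i < D) = minn N D)%N by exact: geq_minr.
elim: N => [|N IH]; first by rewrite big_ord0 min0n.
by rewrite big_ord_recr /= IH; lia.
Qed.

Lemma sum_shallow_le (N D : nat) :
  (\sum_(i < N) ~~ ((D <= i) && (i + D < N))%N <= D + D)%N.
Proof.
apply: (@leq_trans (\sum_(i < N) (i < D) + \sum_(i < N) (rev_ord i < D))%N); last first.
  rewrite leq_add ?sum_lt_le//.
  by have := sum_lt_le N D; rewrite (reindex_inj rev_ord_inj).
rewrite -big_split; apply: leq_sum => i _ /=; have := ltn_ord i; lia.
Qed.

(** At most [2 D] indices lie near the ends; their share is at most [2 D (K + cabs c) / N], and [N0]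
    is chosen to bring it below [e / 2]. *)
Lemma average_deep (x : forall N, 'I_N -> C) (c : C) (K : R) :
  (forall N i, cabs (x N i) <= K) ->
  (forall e, 0 < e -> exists D : nat, forall N (i : 'I_N),
     (D <= i)%N -> (i + D < N)%N -> cabs (x N i - c) <= e) ->
  cvgC (fun N => rC (N%:R^-1) * \sum_(i < N) x N i) c.
Proof.
move=> xK xc e e0; have e20 : 0 < e / 2 by lra.
have [D hD] := xc _ e20; pose B := K + cabs c.
have B0 : 0 <= `|B| by exact: normr_ge0.
pose N0 := (Num.truncn (2 * (D + D)%:R * `|B| / e)).+1.
have hN0 : 2 * (D + D)%:R * `|B| / e <= N0%:R by apply/ltW/truncnS_gt.
exists N0 => N NN0; have N00 : 0 < N%:R :> R by rewrite ltr0n; lia.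
have NE : 2 * (D + D)%:R * `|B| <= e * N%:R.
  rewrite [leRHS]mulrC -ler_pdivrMr//.
  by apply: le_trans hN0 _; rewrite ler_nat.
have -> : rC (N%:R^-1) * \sum_(i < N) x N i - c = rC (N%:R^-1) * \sum_(i < N) (x N i - c).
  rewrite sumrB mulrBr; congr (_ - _); rewrite sumr_const card_ord -[c *+ N]mulr_natl mulrA.
  have -> : (N%:R : C) = rC N%:R by rewrite rC_is_real_complex rmorph_nat.
  by rewrite -rCM mulVf ?gt_eqF// mul1r.
rewrite cabsM cabs_rC ger0_norm ?invr_ge0 ?ler0n// ler_pdivrMl//.
apply: le_trans (cabs_sum _ _ _) _.
apply: (@le_trans _ _ (\sum_(i < N) (e / 2 + `|B| * (~~ ((D <= i) && (i + D < N))%N)%:R))).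
  apply: ler_sum => i _; case: (boolP (_ && _)) => /= [/andP[h1 h2]|_].
    by rewrite mulr0 addr0 hD.
  apply: le_trans (cabsB _ _) _; rewrite mulr1.
  by apply: le_trans (lerD (xK N i) (lexx _)) _; rewrite ler_wpDl ?ler_norm// ltW.
rewrite big_split /= sumr_const card_ord -mulr_sumr -natr_sum.
have : (\sum_(i < N) ~~ ((D <= i) && (i + D < N)))%N%:R <= (D + D)%:R :> R.
  by rewrite ler_nat sum_shallow_le.
move: (_%N%:R) => S SD; rewrite -mulr_natl.
have : `|B| * S <= `|B| * (D + D)%:R by rewrite ler_wpM2l.
lra.
Qed.

(** On the diagonal only the zeroth Fourier coefficient occurs, that is, the integral. Dividing by
    [N] although the size is [2 N] leaves the full trace of the symbol. *)
Lemma trace_cvg (F : R -> 'M[C]_2) M : asymp_symbol F M ->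
  cvgC (fun N => rC (N%:R^-1) * \tr (M N)) (cint (fun l => \tr (F l))).
Proof.
move=> [mF [K MK] hF].
rewrite (_ : cint _ = \sum_(u < 2) cint (fun l => F l u u)); last by rewrite -cint_sum.
apply: (@eq_cvgC (fun N => \sum_(u < 2) rC (N%:R^-1) * \sum_(i < N) M N (blk u i) (blk u i))).
  by move=> N; rewrite /mxtrace sum_blk mulr_sumr.
apply: cvgC_sum => u; apply: average_deep => [N i|e e0]; first exact: MK.
have [D hD] := hF e e0; exists D => N i h1 h2.
have := hD N u u i i h1 h2; rewrite subrr /fourier_coef.
have -> // : cint (fun l => F l u u * expj (- (2 * pi * l * 0%:~R))) = cint (fun l => F l u u).
by apply: eq_cint => l; rewrite mulr0 oppr0 expj0 mulr1.
Qed.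

Lemma eq_asymp_symbol (F G : R -> 'M[C]_2) (M M' : forall N, 'M[C]_(N + N)) : (forall l, F l = G l) ->
  (forall N, M N = M' N) -> asymp_symbol F M -> asymp_symbol G M'.
Proof.
move=> /funext -> MM [mF [K MK] hF]; split => //.
  by exists K => N p q; rewrite -MM.
by move=> e /hF[D h]; exists D => N u v i j; rewrite -MM; exact: h.
Qed.

Lemma asymp_symbolX (a b : 'I_2 -> 'I_2 -> int -> C) k : (forall u v, abs_summable_Z (a u v)) ->
  (forall u v, abs_summable_Z (b u v)) ->
  asymp_symbol (fun l => (bsymb a l *m bsymb b l) ^+ k)
               (fun N => (btoep a N *m btoep b N) ^+ k).
Proof.
move=> sa sb; elim: k => [|k IH]; first exact: asymp_symbol1.
apply: eq_asymp_symbol (asymp_symbolM sa (asymp_symbolM sb IH)) => [l|N].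
  by rewrite mulmxA exprS.
by rewrite mulmxA exprS.
Qed.

(** Grouped by differences, the average is the Fejér mean, with weights 1 - |n|/N. It is kept as a
    double sum because in this form it is a Toeplitz quadratic form at a vector of exponentials. *)
Lemma fejer_cvg (a : int -> C) (l : R) : abs_summable_Z a ->
  cvgC (fun N => rC (N%:R^-1) * \sum_(i < N) \sum_(j < N)
    a (i%:Z - j%:Z) * expj (2 * pi * l * (i%:Z - j%:Z)%:~R)) (symb a l).
Proof.
move=> sa; pose b n := a n * expj (2 * pi * l * n%:~R).
have ab n : cabs (a n) = cabs (b n) by exact: cabs_mul_expj.
have sb : abs_summable_Z b by exact: abs_summable_eq_cabs sa.
have [M bM] := sb.
apply: (@average_deep (fun N (i : 'I_N) => \sum_(j < N) b (i%:Z - j%:Z)) _ M) => [N i|e e0].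
  apply: le_trans (cabs_sum _ _ _) _; apply: le_trans (bM N).
  by apply: (sum_shift_le (b := fun n => cabs (b n))) => // n; exact: cabs_ge0.
have [d bd] := summable_tail sb (divr_gt0 e0 (ltr0n R 3)).
exists d => N i di idN.
rewrite -(subrKA (psum b d)); apply: le_trans (cabsD _ _) _.
have -> : e = e / 3 + 2 * (e / 3) by field.
apply: lerD; last by rewrite -cabsN opprB; exact: zsumC_approx.
have := @sum_window_tail_le _ b d N i (fun=> 1) (fun=> 1) M 0 (e / 3) 1 bM bd (lexx _) ler01.
rewrite mulr0 add0r mulr1 => H; apply: le_trans (H _ _); last 2 first.
- by move=> j _; rewrite subrr cabs0.
- by move=> j; rewrite cabs1.
rewrite -(@sum_shift_window _ b d N i)//.
by under [X in _ <= cabs (X - _)]eq_bigr do rewrite mulr1;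
   under [X in _ <= cabs (_ - X)]eq_bigr do rewrite mulr1.
Qed.

End Averages.

(** * Positive semidefinite matrices, eigenvalues of products, and log-determinants *)

Section PositiveMatrices.
Variable R : realType.
Local Notation C := (R[i]).

Definition ctr m n (A : 'M[C]_(m, n)) : 'M[C]_(n, m) := \matrix_(i, j) Defs.conjc (A j i).
(** The inequality in [R[i]] also says that the form is real, which is the source of Hermitian
    symmetry in [psd2_herm]. *)
Definition psdmx n (A : 'M[C]_n) := forall v : 'rV[C]_n, 0 <= (v *m A *m ctr v) 0 0.

Lemma cconjD (z w : C) : Defs.conjc (z + w) = Defs.conjc z + Defs.conjc w.
Proof. by rewrite !conjcE rmorphD. Qed.
Lemma cconjM (z w : C) : Defs.conjc (z * w) = Defs.conjc z * Defs.conjc w.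
Proof. by rewrite !conjcE rmorphM. Qed.
Lemma cconjK (z : C) : Defs.conjc (Defs.conjc z) = z.
Proof. by apply: complex_ext; rewrite /= ?opprK. Qed.
Lemma cconj_sum I (r : seq I) (P : pred I) (F : I -> C) :
  Defs.conjc (\sum_(i <- r | P i) F i) = \sum_(i <- r | P i) Defs.conjc (F i).
Proof.
by apply: (big_morph _ cconjD); apply: complex_ext; rewrite /= ?oppr0.
Qed.
Lemma cconj_rC (x : R) : Defs.conjc (rC x) = rC x.
Proof. by apply: complex_ext; rewrite /= ?oppr0. Qed.

Lemma qformE n (A : 'M[C]_n) (v : 'rV[C]_n) :
  (v *m A *m ctr v) 0 0 = \sum_i \sum_j v 0 i * A i j * Defs.conjc (v 0 j).
Proof.
rewrite mxE exchange_big /=; apply: eq_bigr => j _.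
by rewrite !mxE mulr_suml; apply: eq_bigr => i _; rewrite ?mxE.
Qed.

Lemma ctr_mul m n p (A : 'M[C]_(m, n)) (B : 'M[C]_(n, p)) : ctr (A *m B) = ctr B *m ctr A.
Proof.
apply/matrixP => i j; rewrite !mxE cconj_sum; apply: eq_bigr => k _.
by rewrite !mxE cconjM mulrC.
Qed.

Lemma ctrB m n (A B : 'M[C]_(m, n)) : ctr (A - B) = ctr A - ctr B.
Proof.
by apply/matrixP => i j; rewrite !mxE; apply: complex_ext; rewrite !ReImE//= opprD.
Qed.

Lemma ctrZ m n (a : R) (A : 'M[C]_(m, n)) : ctr (rC a *: A) = rC a *: ctr A.
Proof. by apply/matrixP => i j; rewrite !mxE cconjM cconj_rC. Qed.

Lemma sqnorm_rv n (u : 'rV[C]_n) :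
  (u *m ctr u) 0 0 = rC (\sum_i cabs (u 0 i) ^+ 2).
Proof.
rewrite mxE rC_is_real_complex rmorph_sum; apply: eq_bigr => i _.
by rewrite mxE mulC_conj.
Qed.

(** First-order variation: with [u = v A], the form at [v - t u] equals [- 2 t s + t^2 q], where [s]
    is the squared norm of [u]. If [s > 0], this is negative for small positive [t]. *)
Lemma psdmx_ker n (A : 'M[C]_n) (v : 'rV[C]_n) : ctr A = A -> psdmx A ->
  (v *m A *m ctr v) 0 0 = 0 -> v *m A = 0.
Proof.
move=> hA pA v0; set u := v *m A.
pose s := \sum_i cabs (u 0 i) ^+ 2; pose q := Re ((u *m A *m ctr u) 0 0).
have qE : (u *m A *m ctr u) 0 0 = rC q.
  have := pA u; rewrite lecE /= => /andP[/eqP Im0 _].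
  by apply: complex_ext; rewrite //= Im0.
have q0 : 0 <= q by have := pA u; rewrite lecE /= => /andP[_].
have s0 : 0 <= s by apply: sumr_ge0 => i _; rewrite sqr_ge0.
have key (t : R) : 0 <= - (t * s) - t * s + t * t * q.
  have := pA (v - rC t *: u).
  have -> : ((v - rC t *: u) *m A *m ctr (v - rC t *: u)) 0 0 =
    rC (- (t * s) - t * s + t * t * q).
    rewrite ctrB ctrZ !mulmxBl !mulmxBr -!scalemxAl -!scalemxAr.
    have h2 : A *m ctr v = ctr u by rewrite /u ctr_mul hA.
    have entry (X Y Z W : 'M[C]_1) :
      (X - rC t *: Y - (rC t *: Z - rC t *: (rC t *: W))) 0 0 =
      X 0 0 - rC t * Y 0 0 - (rC t * Z 0 0 - rC t * (rC t * W 0 0)) by rewrite !mxE.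
    rewrite entry v0 -(mulmxA u A (ctr v)) h2 -/u sqnorm_rv -/s qE.
    by rewrite !rCD !rCN !rCM; ring.
  by rewrite lecE /= => /andP[].
have s_eq0 : s = 0.
  (* This [t] is positive and small enough for every [q >= 0]: the value is -s^2 (q+2)/(q+1)^2. *)
  have := key (s / (q + 1)).
  have q1 : 0 < q + 1 by lra.
  have -> : - (s / (q + 1) * s) - s / (q + 1) * s + s / (q + 1) * (s / (q + 1)) * q
     = - (s ^+ 2 * ((q + 2) / (q + 1) ^+ 2)) by field; rewrite gt_eqF.
  rewrite oppr_ge0 pmulr_lle0; last by rewrite divr_gt0 ?exprn_gt0//; lra.
  by move=> h; apply/eqP; rewrite -sqrf_eq0 eq_le h sqr_ge0.
apply/rowP => i; rewrite [RHS]mxE; apply: cabs_eq0; apply/eqP; rewrite -sqrf_eq0.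
move/eqP: s_eq0; rewrite psumr_eq0 => [/allP/(_ i)|j _]; last exact: sqr_ge0.
by rewrite mem_index_enum => /(_ isT).
Qed.

(** Testing [S] at [v G] gives [z g >= 0], where [g] is the form of [G] at [v]. If [g > 0], divide;
    if [g = 0], then [v G = 0] by [psdmx_ker] and so [z = 0]. A singular [G] is thus covered. *)
Lemma eigen_psd_mul n (G S : 'M[C]_n) (v : 'rV[C]_n) (z : C) :
  ctr G = G -> psdmx G -> psdmx S -> v != 0 -> v *m (G *m S) = z *: v -> 0 <= z.
Proof.
move=> hG pG pS v0 vz; set g := (v *m G *m ctr v) 0 0.
have zg : 0 <= z * g.
  have := pS (v *m G); rewrite -(mulmxA v) vz ctr_mul hG -scalemxAl mxE.
  by rewrite mulmxA.
have [g0|g0] := eqVneq g 0.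
  have vG := psdmx_ker hG pG g0.
  move: vz; rewrite mulmxA vG mul0mx => /esym/eqP; rewrite scaler_eq0 (negbTE v0) orbF.
  by move=> /eqP ->.
have gp : 0 < g by rewrite lt_neqAle eq_sym g0 pG.
by rewrite -(pmulr_lge0 _ gp).
Qed.

(** Left eigenvectors are measured in the l1 norm, for which absolute row sums bound the action of
    [A]. *)
Lemma eigen_row_sum n (A : 'M[C]_n) (v : 'rV[C]_n) (z : C) (B : R) :
  (forall i, \sum_j cabs (A i j) <= B) -> v != 0 -> v *m A = z *: v -> cabs z <= B.
Proof.
move=> AB v0 vz; pose s := \sum_j cabs (v 0 j).
have s0 : 0 < s.
  rewrite lt_neqAle sumr_ge0 ?andbT; last by move=> i _; exact: cabs_ge0.
  apply: contra v0 => /eqP/esym/eqP; rewrite psumr_eq0 => [/allP h|j _]; last exact: cabs_ge0.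
  apply/eqP/rowP => j; rewrite mxE; apply/cabs_eq0/eqP.
  by have := h j; rewrite mem_index_enum => /(_ isT).
rewrite -(ler_pM2r s0) /s mulr_sumr.
have -> : \sum_j cabs z * cabs (v 0 j) = \sum_j cabs ((v *m A) 0 j).
  by apply: eq_bigr => j _; rewrite vz mxE cabsM.
apply: (@le_trans _ _ (\sum_j \sum_i cabs (v 0 i) * cabs (A i j))).
  apply: ler_sum => j _; rewrite mxE; apply: le_trans (cabs_sum _ _ _) _.
  by apply: ler_sum => i _; rewrite cabsM.
rewrite exchange_big mulr_sumr /=; apply: ler_sum => i _.
by rewrite -mulr_sumr mulrC ler_wpM2r ?cabs_ge0.
Qed.

Lemma trig_mulmx n (A B : 'M[C]_n) : is_trig_mx A -> is_trig_mx B ->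
  is_trig_mx (A *m B) /\ forall i, (A *m B) i i = A i i * B i i.
Proof.
move=> /is_trig_mxP tA /is_trig_mxP tB; split.
  apply/is_trig_mxP => i j ij; rewrite mxE big1// => k _.
  have [ik|ki] := ltnP i k; first by rewrite tA// mul0r.
  by rewrite tB ?mulr0//; exact: leq_ltn_trans ij.
move=> i; rewrite mxE (bigD1 i)//= big1 ?addr0// => k ki.
have [ik|ki'] := ltnP i k; first by rewrite tA// mul0r.
by rewrite tB ?mulr0// ltn_neqAle ki' andbT.
Qed.

(** Triangulation replaces diagonalization, since [A] need not be normal: the diagonal of a
    triangular form already determines determinants and traces of powers. Size 0 is split off
    because [Schur] asks for a positive size. *)
Lemma trigonal_eigenvalues n (A : 'M[C]_n) : exists t : 'I_n -> C,
  [/\ forall i, exists2 v : 'rV[C]_n, v != 0 & v *m A = t i *: v,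
      forall c, \det (1%:M + c *: A) = \prod_i (1 + c * t i) &
      forall k, \tr (A ^+ k) = \sum_i t i ^+ k].
Proof.
case: n A => [|n] A.
  exists (fun=> 0); split; first by case.
  - by move=> c; rewrite det_mx00 big_ord0.
  - by move=> k; rewrite /mxtrace !big_ord0.
have [P Pu] := Schur A (ltn0Sn n).
have Pun := unitarymx_unit Pu.
rewrite /= /mxred.similar_to mxred.conjumx// => tL.
set L := P *m A *m invmx P in tL.
have LE : L = P *m A *m invmx P by [].
clearbody L.
have AE : A = invmx P *m L *m P by rewrite LE !mulmxA mulVmx// mul1mx mulmxKV.
have LX k : P *m (A ^+ k) *m invmx P = L ^+ k.
  elim: k => [|k IH]; first by rewrite !expr0 mulmx1 mulmxV.
  by rewrite !exprS -IH LE -!mulmxE !mulmxA mulmxKV.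
have tLX k : is_trig_mx (L ^+ k) /\ forall i, (L ^+ k) i i = L i i ^+ k.
  elim: k => [|k [IH1 IH2]].
    split; first by rewrite expr0; exact: scalar_mx_is_trig.
    by move=> i; rewrite !expr0 mxE eqxx.
  have [h1 h2] := trig_mulmx tL IH1.
  by rewrite exprS; split => // i; rewrite h2 IH2 exprS.
exists (fun i => L i i); split.
- move=> i; have : eigenvalue L (L i i).
    rewrite eigenvalue_root_char char_poly_trig// rootE horner_prod.
    by rewrite (bigD1 i)//= hornerXsubC subrr mul0r.
  move=> /eigenvalueP[v vL v0]; exists (v *m P).
    by apply: contra v0 => /eqP h; rewrite -(mulmxK Pun v) h mul0mx.
  by rewrite {1}AE !mulmxA mulmxK// vL scalemxAl.
- move=> c; have -> : \det (1%:M + c *: A) = \det (1%:M + c *: L).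
    have -> : 1%:M + c *: L = P *m (1%:M + c *: A) *m invmx P.
      by rewrite mulmxDr mulmxDl mulmx1 mulmxV// LE -scalemxAr -scalemxAl.
    by rewrite !det_mulmx mulrAC -det_mulmx mulmxV// det1 mul1r.
  rewrite det_trig; first by apply: eq_bigr => i _; rewrite !mxE eqxx.
  apply/is_trig_mxP => i j ij; rewrite !mxE (is_trig_mxP tL)// mulr0 addr0.
  by rewrite (_ : i == j = false)//; apply/negbTE; rewrite neq_ltn ij.
- move=> k; have [_ h] := tLX k; under eq_bigr do rewrite -h.
  by rewrite -[RHS]/(\tr (L ^+ k)) -LX mxtrace_mulC mulmxA mulVmx// mul1mx.
Qed.

(** The trace of [p(A)], expanded into the traces of powers whose limits are known. *)
Definition trpoly n (p : {poly R}) (A : 'M[C]_n) : C :=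
  \sum_(k < size p) rC p`_k * \tr (A ^+ k).

(** Both quantities are sums over the [n] eigenvalues, of [ln (1 + c x)] and of [p.[x]], and these
    differ by at most [e] at each of them. *)
Lemma logdet_trpoly n (A : 'M[C]_n) (c B e : R) (p : {poly R}) : 0 <= c ->
  (forall (v : 'rV[C]_n) z, v != 0 -> v *m A = z *: v -> 0 <= z /\ cabs z <= B) ->
  (forall x, 0 <= x <= B -> `|ln (1 + c * x) - p.[x]| <= e) ->
  `|ln (Re (\det (1%:M + rC c *: A))) - Re (trpoly p A)| <= n%:R * e.
Proof.
move=> c0 eA hp; have [t [et dt trt]] := trigonal_eigenvalues A.
have tx i : t i = rC (Re (t i)) /\ 0 <= Re (t i) <= B.
  have [v v0 vt] := et i; have [] := eA v (t i) v0 vt.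
  rewrite lecE /= => /andP[/eqP Im0 Re0] tB; split.
    by apply: complex_ext.
  by rewrite Re0 /=; apply: le_trans tB; apply: le_trans (Re_cabs _); exact: ler_norm.
pose x i := Re (t i).
have x1 i : 0 < 1 + c * x i by have [_ /andP[h _]] := tx i; rewrite ltr_pwDl// mulr_ge0.
have -> : Re (\det (1%:M + rC c *: A)) = \prod_i (1 + c * x i).
  rewrite dt (_ : \prod_i _ = rC (\prod_i (1 + c * x i)))//.
  rewrite rC_is_real_complex rmorph_prod; apply: eq_bigr => i _.
  by rewrite {1}(tx i).1 -rCM -[1 in LHS]/(rC 1) -rCD.
have -> : ln (\prod_i (1 + c * x i)) = \sum_i ln (1 + c * x i).
  suff [] : 0 < \prod_i (1 + c * x i) /\
    ln (\prod_i (1 + c * x i)) = \sum_i ln (1 + c * x i) by [].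
  elim/big_ind2 : _ => [|a b a' b' [a0 <-] [b0 <-]|i _]; first by rewrite ln1.
    by rewrite lnM ?posrE// mulr_gt0.
  by [].
have -> : Re (trpoly p A) = \sum_i p.[x i].
  rewrite /trpoly Re_sum (eq_bigr (fun k : 'I__ => \sum_i p`_k * x i ^+ k)); last first.
    move=> k _; rewrite trt mulr_sumr Re_sum; apply: eq_bigr => i _.
    rewrite (tx i).1 rC_is_real_complex -rmorphXn -rmorphM /=.
    by [].
  by rewrite exchange_big; apply: eq_bigr => i _; rewrite horner_coef.
rewrite -sumrB; apply: le_trans (ler_norm_sum _ _ _) _.
apply: (@le_trans _ _ (\sum_(i < n) e)); last by rewrite sumr_const card_ord mulr_natl.
by apply: ler_sum => i _; apply: hp; exact: (tx i).2.
Qed.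

End PositiveMatrices.

(** * Uniform polynomial approximation of the logarithm *)

Section LogPolynomials.
Variable R : realType.

Definition ln1_taylor (K : nat) (y : R) : R :=
  \sum_(k < K) (-1) ^+ k / k.+1%:R * y ^+ k.+1.

(** Differentiation turns the Taylor sum into a finite geometric sum, whose difference from 1/(1+y)
    is a single term. *)
Lemma is_derive_ln1_remainder (K : nat) (y : R) : -1 < y ->
  is_derive y (1 : R) (fun y => ln (1 + y) - ln1_taylor K y) ((- y) ^+ K / (1 + y)).
Proof.
move=> y1; have y10 : 0 < 1 + y by lra.
elim: K => [|K IH].
  rewrite expr0 div1r (_ : (fun _ => _) = @ln R \o (fun y => 1 + y)); last first.
    by apply/funext => z /=; rewrite /ln1_taylor big_ord0 subr0.
  rewrite -[X in is_derive _ _ _ X]mulr1; apply: is_derive1_comp; first exact: is_derive1_ln.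
  by rewrite -[X in is_derive _ _ _ X]add0r; exact: is_deriveD.
rewrite (_ : (fun _ => _) = (fun y => ln (1 + y) - ln1_taylor K y) -
   (fun y => (-1) ^+ K / K.+1%:R * y ^+ K.+1)); last first.
  by apply/funext => z; rewrite /ln1_taylor big_ord_recr /= opprD addrA.
have -> : (- y) ^+ K.+1 / (1 + y) = (- y) ^+ K / (1 + y) - (- y) ^+ K.
  by rewrite exprS; field; rewrite gt_eqF.
apply: is_deriveB.
have -> : (- y) ^+ K = (-1) ^+ K / K.+1%:R * (K.+1%:R * y ^+ K).
  by rewrite [LHS]exprNn [RHS]mulrA divfK ?pnatr_eq0.
apply: is_deriveZ.
have := is_deriveX K.+1 (is_derive_id y (1 : R)).
by rewrite /GRing.scale /= mulr1 exprfctE.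
Qed.

(** Mean value theorem between 0 and [y], where the derivative of the remainder is at most
    [q ^+ K / (1 - q)]; the sign of [y] only decides the order of the endpoints. *)
Lemma ln1_taylor_bound (q : R) (K : nat) (y : R) : 0 <= q < 1 -> `|y| <= q ->
  `|ln (1 + y) - ln1_taylor K y| <= q ^+ K / (1 - q).
Proof.
move=> /andP[q0 q1] yq; pose f y := ln (1 + y) - ln1_taylor K y.
have f0 : f 0 = 0.
  rewrite /f addr0 ln1 /ln1_taylor big1 ?subr0// => k _.
  by rewrite expr0n mulr0.
have df z : `|z| <= q -> is_derive z (1 : R) f ((- z) ^+ K / (1 + z)).
  by rewrite ler_norml => /andP[h _]; apply: is_derive_ln1_remainder; lra.
have bound z : `|z| <= q -> `|(- z) ^+ K / (1 + z)| <= q ^+ K / (1 - q).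
  move=> zq; have := zq; rewrite ler_norml => /andP[z1 z2].
  rewrite normrM normrX normrN normfV (@ger0_norm _ (1 + z)); last by lra.
  apply: ler_pM; rewrite ?exprn_ge0 ?invr_ge0//; first by lra.
    by rewrite lerXn2r ?nnegrE.
  by rewrite lef_pV2 ?posrE; lra.
have cf z : `|z| <= q -> {for z, continuous f}.
  by move=> /df[d _]; apply/differentiable_continuous/derivable1_diffP.
have [y0|y0] := leP 0 y.
  have [||z zin fy] := @MVT_segment R f (fun z => (- z) ^+ K / (1 + z)) 0 y y0.
  - move=> z; rewrite in_itv /= => /andP[z0 zy]; apply: df.
    by rewrite ger0_norm ?(ltW z0)//; move: yq; rewrite ger0_norm//; lra.
  - apply: continuous_in_subspaceT => z; rewrite inE /= in_itv /= => /andP[z0 zy].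
    by apply: cf; rewrite ger0_norm//; move: yq; rewrite ger0_norm//; lra.
  rewrite -/(f y) -[f y]subr0 -f0 fy subr0 normrM.
  have zq : `|z| <= q.
    move: zin; rewrite in_itv /= => /andP[z0 zy].
    by rewrite ger0_norm//; move: yq; rewrite ger0_norm//; lra.
  by rewrite -[leRHS]mulr1 ler_pM// ?bound//; lra.
have [||z zin fy] := @MVT_segment R f (fun z => (- z) ^+ K / (1 + z)) y 0 (ltW y0).
- move=> z; rewrite in_itv /= => /andP[z0 zy]; apply: df.
  by rewrite ltr0_norm//; move: yq; rewrite ltr0_norm//; lra.
- apply: continuous_in_subspaceT => z; rewrite inE /= in_itv /= => /andP[z0 zy].
  by apply: cf; rewrite ler0_norm//; move: yq; rewrite ltr0_norm//; lra.
rewrite -/(f y) -normrN -[- f y]add0r -f0 fy sub0r normrM.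
have zq : `|z| <= q.
  move: zin; rewrite in_itv /= => /andP[z0 zy].
  by rewrite ler0_norm//; move: yq; rewrite ltr0_norm//; lra.
by rewrite -[leRHS]mulr1 ler_pM// ?bound// normrN; lra.
Qed.

(* Expanding at the midpoint of [0, B] makes the Taylor series converge
   uniformly, with ratio (cB/2) / (1 + cB/2) < 1. *)
Lemma ln_poly_approx (c B e : R) : 0 < c -> 0 <= B -> 0 < e ->
  exists p : {poly R}, forall x, 0 <= x <= B -> `|ln (1 + c * x) - p.[x]| <= e.
Proof.
move=> c0 B0 e0; pose h := c * B / 2; pose m := 1 + h.
have h0 : 0 <= h by rewrite /h divr_ge0// mulr_ge0// ltW.
have m0 : 0 < m by rewrite /m; lra.
pose q := h / m.
have q0 : 0 <= q by rewrite divr_ge0// ltW.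
have q1 : q < 1 by rewrite /q ltr_pdivrMr// /m; lra.
have [K hK] : exists K, q ^+ K / (1 - q) <= e.
  have : GRing.exp q @ \oo --> (0 : R) by apply: cvg_expr; rewrite ger0_norm.
  move/cvgrPdist_le => /(_ (e * (1 - q))) []; first by rewrite mulr_gt0//; lra.
  move=> K _ /(_ K (leqnn K)); rewrite sub0r normrN ger0_norm ?exprn_ge0// => hK.
  by exists K; rewrite ler_pdivrMr//; lra.
pose Y : {poly R} := (c / m) *: 'X - (h / m)%:P.
exists ((ln m)%:P + \sum_(k < K) ((-1) ^+ k / k.+1%:R) *: Y ^+ k.+1) => x /andP[x0 xB].
pose y := c / m * x - h / m.
have -> : ((ln m)%:P + \sum_(k < K) ((-1) ^+ k / k.+1%:R) *: Y ^+ k.+1).[x] =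
  ln m + ln1_taylor K y.
  rewrite hornerD hornerC horner_sum; congr (_ + _); apply: eq_bigr => k _.
  by rewrite hornerZ horner_exp /Y !hornerE.
have yq : `|y| <= q.
  rewrite /y /q (_ : c / m * x - h / m = (c * x - h) / m); last by field; rewrite gt_eqF.
  rewrite normrM normfV (gtr0_norm m0) ler_pM2r ?invr_gt0// ler_norml.
  have : c * x <= c * B by rewrite ler_wpM2l// ltW.
  have : 0 <= c * x by rewrite mulr_ge0// ltW.
  by rewrite /h; lra.
have -> : 1 + c * x = m * (1 + y).
  by rewrite /y /m; field; rewrite -/m gt_eqF.
have y1 : 0 < 1 + y by move: yq; rewrite ler_norml => /andP[]; lra.
rewrite lnM ?posrE// opprD addrACA subrr add0r.
apply: le_trans hK; apply: ln1_taylor_bound => //.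
by rewrite q0.
Qed.

End LogPolynomials.

(** * Gram matrices and translation invariance of the integral *)

Section GramMatrices.
Variable R : realType.
Local Notation C := (R[i]).
Local Notation mu := (@lebesgue_measure R).

(** The quadratic form commutes with the integral. The domain is a parameter because pulses live on
    the whole line and spectra on [Ihalf]. *)
Lemma psd_cintegral (D : set R) n (h : 'I_n -> 'I_n -> R -> C) : measurable D ->
  (forall a b, cintegrable D (h a b)) ->
  (forall s, D s -> psdmx (\matrix_(a, b) h a b s)) ->
  psdmx (\matrix_(a, b) cintegral D (h a b)).
Proof.
move=> mD ih hpos v; rewrite qformE.
have ihv a b : cintegrable D (fun s => v 0 a * Defs.conjc (v 0 b) * h a b s).
  exact: cintegrableZ.
have -> : \sum_a \sum_b v 0 a * (\matrix_(a, b) cintegral D (h a b)) a b * Defs.conjc (v 0 b) =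
  cintegral D (fun s => \sum_a \sum_b v 0 a * Defs.conjc (v 0 b) * h a b s).
  rewrite cintegral_sum//; last by move=> a; exact: cintegrable_sum.
  apply: eq_bigr => a _; rewrite cintegral_sum//; apply: eq_bigr => b _.
  by rewrite cintegralZ// mxE mulrAC.
have pos s : D s -> 0 <= \sum_a \sum_b v 0 a * Defs.conjc (v 0 b) * h a b s.
  move=> /hpos/(_ v); rewrite qformE.
  congr (0 <= _); apply: eq_bigr => a _; apply: eq_bigr => b _.
  by rewrite mxE mulrAC.
rewrite lecE /=; apply/andP; split.
  apply/eqP; rewrite [LHS](_ : _ = Rint D (fun=> 0)).
    by rewrite /Defs.Rint Rintegral_cst// mul0r.
  by apply: eq_Rintegral => s /set_mem/pos; rewrite lecE /= => /andP[/eqP].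
by apply: Rintegral_ge0 => s /pos; rewrite lecE /= => /andP[].
Qed.

Lemma psd_rank1 n (w : R) (f : 'I_n -> C) : 0 <= w ->
  psdmx (\matrix_(a, b) (rC w * (f a * Defs.conjc (f b)))).
Proof.
move=> w0 v; rewrite qformE.
have -> : \sum_i \sum_j v 0 i * (\matrix_(a, b) (rC w * (f a * Defs.conjc (f b)))) i j *
  Defs.conjc (v 0 j) = rC (w * cabs (\sum_i v 0 i * f i) ^+ 2).
  rewrite rCM -mulC_conj cconj_sum mulr_suml mulr_sumr; apply: eq_bigr => i _.
  rewrite !mulr_sumr; apply: eq_bigr => j _; rewrite mxE cconjM; ring.
by rewrite lecE /= eqxx mulr_ge0// sqr_ge0.
Qed.

Definition shiftR (t x : R) : R := x + t.

Lemma measurable_shiftR t :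
  measurable_fun setT (shiftR t : measurableTypeR R -> measurableTypeR R).
Proof.
have mid : measurable_fun setT (fun x : R => x) by [].
exact: (measurable_funD mid (measurable_cst t)).
Qed.

Definition shift_measure t : {measure set (measurableTypeR R) -> \bar R} :=
  measure_function_pushforward__canonical__measure_function_Measure mu (measurable_shiftR t).

(** The push-forward agrees with Lebesgue measure on half-open intervals, and uniqueness does the
    rest. *)
Lemma lebesgue_measure_shift t (A : set R) : measurable A -> mu A = shift_measure t A.
Proof.
move: A; apply: lebesgue_measure_unique => _ [[a b] _ <-] /=.
rewrite /pushforward (_ : shiftR t @^-1` _ = `]a - t, b - t]%classic); last first.
  by apply/seteqP; split => x /=; rewrite /shiftR !in_itv /= ltrBlDr lerBrDr.
rewrite !lebesgue_measure_itv /= !lte_fin ltrD2r.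
by case: ifP => // _; rewrite -!EFinB; congr (_%:E); ring.
Qed.

Lemma ge0_integral_shift t (f : R -> \bar R) : measurable_fun setT f ->
  (forall x, 0 <= f x)%E -> (\int[mu]_x f (x + t)%R = \int[mu]_x f x)%E.
Proof.
move=> mf f0; transitivity (\int[shift_measure t]_x f x)%E.
  by rewrite /shift_measure /= ge0_integral_pushforward//; exact: measurable_shiftR.
by apply: eq_measure_integral => A mA _; rewrite -lebesgue_measure_shift.
Qed.

Lemma integrable_shift t (f : R -> R) : mu.-integrable setT (EFin \o f) ->
  mu.-integrable setT (EFin \o (fun x => f (x + t))).
Proof.
move=> /integrableP[mf fi]; apply/integrableP; split.
  by apply: (measurableT_comp mf); exact: measurable_shiftR.
rewrite (@ge0_integral_shift t (fun x => `|(f x)%:E|)%E)//.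
exact: measurableT_comp.
Qed.

Lemma Rint_shift t (f : R -> R) : mu.-integrable setT (EFin \o f) ->
  Rint setT (fun x => f (x + t)) = Rint setT f.
Proof.
move=> fi; congr fine; transitivity (\int[shift_measure t]_x (f x)%:E)%E.
  rewrite /shift_measure /= integral_pushforward//; first exact: measurable_shiftR.
    by case/integrableP : fi.
  by rewrite preimage_setT; exact: integrable_shift.
by apply: eq_measure_integral => A mA _; rewrite -lebesgue_measure_shift.
Qed.

End GramMatrices.

(** * Positivity passes from Toeplitz matrices to the symbol *)

Section SymbolPositivity.
Variable R : realType.
Local Notation C := (R[i]).

Definition unblk (T : Type) N (f : 'I_2 -> 'I_N -> T) (p : 'I_(N + N)) : T :=
  match fintype.split p with inl i => f 0 i | inr i => f 1 i end.

Lemma unblkE T N (f : 'I_2 -> 'I_N -> T) u i : unblk f (blk u i) = f u i.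
Proof.
rewrite /unblk /blk; case: (ord2P u) => -> /=.
  by rewrite (unsplitK (inl i : 'I_N + 'I_N)).
by rewrite (unsplitK (inr i : 'I_N + 'I_N)).
Qed.

(** At the modulated vector with entries [v 0 u * e i], the quadratic form of the Toeplitz matrix
    divided by [N] is the Fejér mean of the form of the symbol at [v]. Its limit is nonnegative. *)
Lemma psd_bsymb (a : 'I_2 -> 'I_2 -> int -> C) (l : R) :
  (forall u v, abs_summable_Z (a u v)) -> (forall N, psdmx (btoep a N)) ->
  psdmx (bsymb a l).
Proof.
move=> sa pa v; rewrite qformE.
pose e (n : int) : C := expj (2 * pi * l * n%:~R).
pose w N : 'rV[C]_(N + N) := \row_p unblk (fun u (i : 'I_N) => v 0 u * e i%:Z) p.
apply: (@cvgC_ge0 _ (fun N => rC (N%:R^-1) * (w N *m btoep a N *m ctr (w N)) 0 0)).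
  move=> N; apply: mulr_ge0; last exact: pa.
  by rewrite lecE /= eqxx invr_ge0 ler0n.
apply: (@eq_cvgC _ (fun N => \sum_u \sum_(u' < 2) v 0 u * Defs.conjc (v 0 u') *
   (rC (N%:R^-1) * \sum_(i < N) \sum_(j < N)
    a u u' (i%:Z - j%:Z) * expj (2 * pi * l * (i%:Z - j%:Z)%:~R)))).
  move=> N; rewrite qformE sum_blk mulr_sumr; apply: eq_bigr => u _.
  transitivity (rC N%:R^-1 * \sum_(i < N) \sum_(u' < 2) \sum_(j < N)
     (w N) 0 (blk u i) * btoep a N (blk u i) (blk u' j) * Defs.conjc ((w N) 0 (blk u' j)));
    last by congr (_ * _); apply: eq_bigr => i _; rewrite sum_blk.
  rewrite [in RHS]exchange_big [in RHS]mulr_sumr; apply: eq_bigr => u' _.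
  rewrite mulrCA; congr (_ * _); rewrite mulr_sumr; apply: eq_bigr => i _.
  rewrite mulr_sumr; apply: eq_bigr => j _.
  rewrite btoepE !mxE !unblkE cconjM.
  have -> : expj (2 * pi * l * (i%:Z - j%:Z)%:~R) = e i%:Z * Defs.conjc (e j%:Z).
    by rewrite -expjN -expjD; congr expj; rewrite rmorphB /=; ring.
  by ring.
apply: cvgC_sum => u; apply: cvgC_sum => u'.
rewrite mxE (_ : v 0 u * symb (a u u') l * Defs.conjc (v 0 u') =
  v 0 u * Defs.conjc (v 0 u') * symb (a u u') l); last by ring.
by apply: cvgCZ; exact: fejer_cvg.
Qed.

(** Polarization: reality of the form at (1,0), (0,1), (1,1) and (1,j) determines the symmetry of
    the entries. *)
Lemma psd2_herm (A : 'M[C]_2) : psdmx A ->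
  [/\ 0 <= A 0 0, 0 <= A 1 1, A 1 0 = Defs.conjc (A 0 1) & ctr A = A].
Proof.
move=> pA.
have q (x y : C) : 0 <= x * Defs.conjc x * A 0 0 + x * Defs.conjc y * A 0 1 +
   (y * Defs.conjc x * A 1 0 + y * Defs.conjc y * A 1 1).
  have := pA (\row_i (if i == 0 then x else y)); rewrite qformE.
  rewrite !big_ord_recl !big_ord0 /= !addr0 !mxE /=.
  rewrite (_ : lift ord0 ord0 = 1); last exact/val_inj.
  rewrite (_ : ord0 = 0); last exact/val_inj.
  congr (0 <= _); ring.
have c0 : Defs.conjc (0 : C) = 0 by apply: complex_ext; rewrite /= ?oppr0.
have c1 : Defs.conjc (1 : C) = 1 by apply: complex_ext; rewrite /= ?oppr0.
have a0 : 0 <= A 0 0 by have := q 1 0; rewrite c0 c1 !(mul0r, mulr0, mul1r, addr0).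
have a1 : 0 <= A 1 1 by have := q 0 1; rewrite c0 c1 !(mul0r, mulr0, mul1r, add0r).
have h10 : A 1 0 = Defs.conjc (A 0 1).
  have := q 1 1; have := q 1 (Complex 0 1); move: a0 a1.
  rewrite !lecE !ReImE /= => /andP[/eqP i0 _] /andP[/eqP i1 _] /andP[/eqP h1 _] /andP[/eqP h2 _].
  by apply: complex_ext; rewrite ?ReImE /=; lra.
split => //; apply/matrixP => i j; rewrite mxE.
have realE (z : C) : 0 <= z -> Defs.conjc z = z.
  by rewrite lecE /= => /andP[/eqP h _]; apply: complex_ext; rewrite //= h oppr0.
case: (ord2P i) => ->; case: (ord2P j) => ->;
  [exact: realE | by rewrite h10 cconjK | by rewrite h10 | exact: realE].
Qed.

End SymbolPositivity.

(** * The pulse autocorrelation as a Gram kernel *)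

Section PulseGram.
Variable R : realType.
Local Notation C := (R[i]).
Local Notation mu := (@lebesgue_measure R).

(** The product is dominated by [f ^+ 2 + g ^+ 2]. *)
Lemma integrable_mul_L2 (D : set R) (f g : R -> R) : measurable D ->
  measurable_fun D f -> measurable_fun D g ->
  mu.-integrable D (fun s => (f s ^+ 2)%:E) -> mu.-integrable D (fun s => (g s ^+ 2)%:E) ->
  mu.-integrable D (EFin \o (fun s => f s * g s)).
Proof.
move=> mD mf mg f2 g2.
have fg2 : mu.-integrable D (EFin \o (fun s => f s ^+ 2 + g s ^+ 2)) by exact: integrable_addr.
apply: le_integrable fg2 => //.
  by apply/measurable_EFinP; exact: measurable_funM.
move=> s _ /=; rewrite lee_fin [leRHS]ger0_norm ?addr_ge0 ?sqr_ge0//.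
rewrite normrM -(real_normK (num_real (f s))) -(real_normK (num_real (g s))).
have := sqr_ge0 (`|f s| - `|g s|); have := normr_ge0 (f s); have := normr_ge0 (g s).
by nra.
Qed.

Variables pr pim : R -> R.
Hypotheses (mpr : measurable_fun setT pr) (mpi : measurable_fun setT pim).
Hypotheses (pr2 : mu.-integrable setT (fun s => (pr s ^+ 2)%:E))
           (pi2 : mu.-integrable setT (fun s => (pim s ^+ 2)%:E)).

Let p (s : R) : C := Complex (pr s) (pim s).

Let shifted_mul_integrable (f g : R -> R) (a b : R) :
  measurable_fun setT f -> measurable_fun setT g ->
  mu.-integrable setT (fun s => (f s ^+ 2)%:E) -> mu.-integrable setT (fun s => (g s ^+ 2)%:E) ->
  mu.-integrable setT (EFin \o (fun s => f (s + a) * g (s + b))).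
Proof.
move=> mf mg f2 g2; apply: integrable_mul_L2 => //.
- exact: (measurableT_comp mf (measurable_shiftR a)).
- exact: (measurableT_comp mg (measurable_shiftR b)).
- exact: (integrable_shift a f2).
- exact: (integrable_shift b g2).
Qed.

Lemma cintegrable_gram (a b : R) : cintegrable setT (fun s => p (s + a) * Defs.conjc (p (s + b))).
Proof.
split; under eq_fun do rewrite !ReImE /=.
  rewrite (_ : (fun l => _) = fun l => pr (l + a) * pr (l + b) + pim (l + a) * pim (l + b)).
    by apply: integrable_addr => //; exact: shifted_mul_integrable.
  by apply/funext => l; rewrite mulrN opprK.
rewrite (_ : (fun l => _) = fun l => pim (l + a) * pr (l + b) - pr (l + a) * pim (l + b)).
  by apply: integrable_subr => //; exact: shifted_mul_integrable.
by apply/funext => l; rewrite mulrN addrC.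
Qed.

(** Substituting [s + a] for [s] turns the autocorrelation at a difference into an inner product of
    two shifted pulses. *)
Lemma autocorr_gram (a b : R) :
  autocorr pr pim (a - b) = cintegral setT (fun s => p (s + a) * Defs.conjc (p (s + b))).
Proof.
have bE s : s - (a - b) = s + (b - a) by ring.
have sE s : s + a - (a - b) = s + b by ring.
have I (f g : R -> R) : measurable_fun setT f -> measurable_fun setT g ->
  mu.-integrable setT (fun s => (f s ^+ 2)%:E) -> mu.-integrable setT (fun s => (g s ^+ 2)%:E) ->
  mu.-integrable setT (EFin \o (fun s => f s * g (s - (a - b)))).
  move=> mf mg f2 g2; rewrite (_ : (fun s => _) = fun s => f (s + 0) * g (s + (b - a))).
    exact: shifted_mul_integrable.
  by apply/funext => s; rewrite addr0 bE.
apply: complex_ext => /=.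
  rewrite -[LHS](@Rint_shift _ a); last by apply: integrable_addr => //; exact: I.
  by congr (Rint _ _); apply/funext => s; rewrite /= sE mulrN opprK.
rewrite -[LHS](@Rint_shift _ a); last by apply: integrable_subr => //; exact: I.
by congr (Rint _ _); apply/funext => s; rewrite /= sE mulrN addrC.
Qed.

Lemma autocorrN (t : R) : autocorr pr pim (- t) = Defs.conjc (autocorr pr pim t).
Proof.
rewrite -[t]subr0 opprB !autocorr_gram.
have [_ hi] := cintegrable_gram t 0.
apply: complex_ext => /=; first by congr (Rint _ _); apply/funext => s; rewrite /= !mulrN !opprK mulrC; congr (_ + _); exact: mulrC.
rewrite -mulN1r /Defs.Rint -RintegralZl//.
by congr (Rintegral _ _ _); apply/funext => s; rewrite /= mulN1r opprD !mulrN opprK addrC mulrC; congr (_ - _); exact: mulrC.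
Qed.

(** The times are arbitrary, so the two users' delayed sampling grids fit into one Gram matrix. *)
Lemma psd_autocorr n (t : 'I_n -> R) : psdmx (\matrix_(a, b) autocorr pr pim (t a - t b)).
Proof.
have -> : \matrix_(a, b) autocorr pr pim (t a - t b) =
  \matrix_(a, b) cintegral setT (fun s => p (s + t a) * Defs.conjc (p (s + t b))).
  by apply/matrixP => a b; rewrite !mxE autocorr_gram.
apply: psd_cintegral => // [a b|s _]; first exact: cintegrable_gram.
have := @psd_rank1 R n 1 (fun a => p (s + t a)) ler01.
congr psdmx; apply/matrixP => a b; rewrite !mxE.
exact: mul1r.
Qed.

End PulseGram.

(** * Even integrable functions are determined by their cosine coefficients *)

Section FourierUniqueness.
Variable R : realType.
Local Notation C := (R[i]).
Local Notation mu := (@lebesgue_measure R).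

Let mI := @measurable_Ihalf R.
Hint Resolve mI : core.

Lemma bmeasR_cst c : bmeasR (fun _ : R => c).
Proof. by split; [exact: measurable_cst|exists `|c|]. Qed.

Lemma bmeasR_D (f g : R -> R) : bmeasR f -> bmeasR g -> bmeasR (fun l => f l + g l).
Proof.
move=> [mf [K fK]] [mg [L gL]]; split; first exact: measurable_funD.
by exists (K + L) => l; apply: le_trans (ler_normD _ _) _; exact: lerD.
Qed.

Lemma bmeasR_M (f g : R -> R) : bmeasR f -> bmeasR g -> bmeasR (fun l => f l * g l).
Proof.
move=> [mf [K fK]] [mg [L gL]]; split; first exact: measurable_funM.
by exists (K * L) => l; rewrite normrM ler_pM.
Qed.

Lemma bmeasR_cos c : bmeasR (fun l : R => cos (c * l)).
Proof. exact: (bmeas_Re (bmeas_expj c)). Qed.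

Lemma integrable_mul_bmeasR (h k : R -> R) : mu.-integrable Ihalf (EFin \o h) -> bmeasR k ->
  mu.-integrable Ihalf (EFin \o (fun l => h l * k l)).
Proof.
move=> ih [mk [K kK]].
have iKh : mu.-integrable Ihalf (EFin \o (fun l => K * h l)) by exact: integrable_mulrl.
apply: le_integrable iKh => //.
  have /measurable_EFinP mh := measurable_int _ ih.
  apply/measurable_EFinP; apply: measurable_funM => //; exact: measurable_funTS.
move=> l _ /=; rewrite lee_fin !normrM mulrC ler_wpM2r//.
exact: le_trans (kK l) (ler_norm _).
Qed.

Lemma bernoulli_le (a : R) (m : nat) : -1 <= a -> 1 + m%:R * a <= (1 + a) ^+ m.
Proof.
move=> a1; elim: m => [|m IH]; first by rewrite mul0r addr0 expr0.
have a10 : 0 <= 1 + a by lra.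
apply: (@le_trans _ _ ((1 + a) * (1 + m%:R * a))).
  rewrite -[m.+1%:R]natr1 -subr_ge0.
  rewrite (_ : _ - _ = m%:R * a ^+ 2); last by ring.
  by rewrite mulr_ge0// sqr_ge0.
by rewrite exprS ler_wpM2l.
Qed.

(** Polynomials of the kind used in the Brosowski-Deutsch proof of the Stone-Weierstrass theorem.
    The threshold is 1/2 because the product of [2 ^ n] and [u ^+ n] is the n-th power of [2 u]. *)
Definition step_poly (n : nat) (u : R) : R := (1 - u ^+ n) ^+ (2 ^ n).

Lemma step_poly01 n u : 0 <= u <= 1 -> 0 <= step_poly n u <= 1.
Proof.
move=> /andP[u0 u1]; rewrite /step_poly.
have h0 : 0 <= u ^+ n by exact: exprn_ge0.
have h1 : u ^+ n <= 1 by exact: exprn_ile1.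
by rewrite exprn_ge0 ?exprn_ile1//; lra.
Qed.

(** Bernoulli's inequality bounds the polynomial below by 1 - (2u)^n. *)
Lemma step_poly_cvg1 u : 0 <= u < 1 / 2 -> step_poly n u @[n --> \oo] --> (1 : R).
Proof.
move=> /andP[u0 u1].
apply: (@squeeze_cvgr _ _ _ _ (fun n => 1 - (2 * u) ^+ n) (fun=> 1)).
- near=> n; apply/andP; split; last by have /andP[] : 0 <= step_poly n u <= 1 by apply: step_poly01; lra.
  have := @bernoulli_le (- u ^+ n) (2 ^ n).
  rewrite mulrN natrX -exprMn; apply.
  by rewrite lerN2 exprn_ile1//; lra.
- rewrite -[X in _ --> X]subr0; apply: cvgB; first exact: cvg_cst.
  by apply: cvg_expr; rewrite ger0_norm; lra.
- exact: cvg_cst.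
Unshelve. all: by end_near. Qed.

(** Multiplied by (1 + u^n)^(2^n), the polynomial stays at most 1, while by Bernoulli that factor is
    at least (2u)^n. *)
Lemma step_poly_cvg0 u : 1 / 2 < u <= 1 -> step_poly n u @[n --> \oo] --> (0 : R).
Proof.
move=> /andP[u0 u1]; have u20 : 0 < 2 * u by lra.
apply: (@squeeze_cvgr _ _ _ _ (fun=> 0) (fun n => (2 * u)^-1 ^+ n)).
- near=> n; have /andP[h0 h1] : 0 <= step_poly n u <= 1 by apply: step_poly01; lra.
  rewrite h0 /= exprVn -[leRHS]mul1r ler_pdivlMr ?exprn_gt0//.
  have un0 : 0 <= u ^+ n by rewrite exprn_ge0//; lra.
  have un1 : u ^+ n <= 1 by rewrite exprn_ile1//; lra.
  have hb := @bernoulli_le (u ^+ n) (2 ^ n).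
  have {}hb : (2 * u) ^+ n <= (1 + u ^+ n) ^+ (2 ^ n).
    by apply: le_trans (hb _); [rewrite natrX -exprMn; lra|lra].
  apply: le_trans (ler_wpM2l h0 hb) _; rewrite /step_poly -exprMn.
  rewrite exprn_ile1//; nra.
- exact: cvg_cst.
- apply: cvg_expr; rewrite ger0_norm ?invr_ge0; last by lra.
  by rewrite invf_lt1//; lra.
Unshelve. all: by end_near. Qed.

Section EvenFunction.
Variable h : R -> R.
Hypothesis ih : mu.-integrable Ihalf (EFin \o h).
Hypothesis heven : forall l, Ihalf l -> h (- l) = h l.
Hypothesis hcos : forall n : int, Rint Ihalf (fun l => h l * cos (2 * pi * n%:~R * l)) = 0.

Let k (l : R) : R := cos (2 * pi * l).

Lemma bmeasR_poly_cos (P : {poly R}) : bmeasR (fun l => P.[k l]).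
Proof.
elim/poly_ind : P => [|P c IH].
  by under eq_fun do rewrite horner0; exact: bmeasR_cst.
under eq_fun do rewrite !hornerE.
apply: bmeasR_D; last exact: bmeasR_cst.
by apply: bmeasR_M => //; exact: bmeasR_cos.
Qed.

(** All frequencies are carried through the induction, since a factor [cos (2 pi l)] moves [n] by
    one in both directions. *)
Lemma poly_cos_moment (P : {poly R}) (n : int) :
  Rint Ihalf (fun l => h l * (P.[k l] * cos (2 * pi * n%:~R * l))) = 0.
Proof.
elim/poly_ind : P n => [|P c IH] n.
  rewrite (_ : (fun l => _) = fun=> 0); first by rewrite /Defs.Rint Rintegral_cst// mul0r.
  by apply/funext => l; rewrite horner0 mul0r mulr0.
have I (m : int) : mu.-integrable Ihalf
   (EFin \o (fun l => h l * (P.[k l] * cos (2 * pi * m%:~R * l)))).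
  by apply: integrable_mul_bmeasR => //; apply: bmeasR_M; [exact: bmeasR_poly_cos|exact: bmeasR_cos].
have I1 : mu.-integrable Ihalf (EFin \o (fun l => h l * cos (2 * pi * n%:~R * l))).
  by apply: integrable_mul_bmeasR => //; exact: bmeasR_cos.
rewrite (_ : (fun l => _) = fun l =>
   (1 / 2 * (h l * (P.[k l] * cos (2 * pi * (n + 1)%:~R * l))) +
    1 / 2 * (h l * (P.[k l] * cos (2 * pi * (n - 1)%:~R * l)))) +
   c * (h l * cos (2 * pi * n%:~R * l))); last first.
  apply/funext => l; rewrite hornerMXaddC.
  have -> : 2 * pi * (n + 1)%:~R * l = 2 * pi * n%:~R * l + 2 * pi * l :> R.
    by rewrite intrD; ring.
  have -> : 2 * pi * (n - 1)%:~R * l = 2 * pi * n%:~R * l - 2 * pi * l :> R.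
    by rewrite intrB; ring.
  by rewrite cosD cosB -/(k l); field.
rewrite /Defs.Rint RintegralD//; last 2 first.
- by apply: integrable_addr => //; exact: integrable_mulrl.
- exact: integrable_mulrl.
rewrite RintegralD//; [|exact: integrable_mulrl|exact: integrable_mulrl].
have E1 := IH (n + 1); have E2 := IH (n - 1); have E3 := hcos n.
rewrite /Defs.Rint in E1 E2 E3.
by rewrite !RintegralZl// E1 E2 E3 !mulr0 !addr0.
Qed.

Lemma poly_cos_Rint (P : {poly R}) : Rint Ihalf (fun l => h l * P.[k l]) = 0.
Proof.
rewrite -[RHS](poly_cos_moment P 0); congr (Rint _ _); apply/funext => l.
by rewrite mulr0 mul0r cos0 mulr1.
Qed.

(** The cosine of 2 pi l is even and decreasing on [0, 1/2], so its sublevel sets in [Ihalf] are the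
    sets |l| > x. *)
Lemma k_lt (x l : R) : 0 <= x <= 1 / 2 -> Ihalf l -> (k l < k x) = (x < `|l|).
Proof.
move=> /andP[x0 x1]; rewrite /Defs.Ihalf /= in_itv /= => /andP[l0 l1].
have kE : k l = k `|l|.
  by rewrite /k; case: ler0P => // _; rewrite mulrN cosN.
have lh : `|l| <= 1 / 2 by rewrite ler_norml l0 l1.
have pi0 : 0 < pi :> R := pi_gt0 R.
rewrite kE /k ltr_cos ?in_itv /=.
- by rewrite ltr_pM2l// mulr_gt0.
- by apply/andP; split; nra.
- by apply/andP; split; [rewrite !mulr_ge0 ?normr_ge0//; lra|have := normr_ge0 l; nra].
Qed.

(** Dominated convergence with majorant |h|: the integrals of [h] against polynomials in the cosine
    all vanish. The only exceptional points are [x] and [-x], where [u] equals 1/2. *)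
Lemma outer_Rint (x : R) : 0 <= x <= 1 / 2 ->
  Rint (Ihalf `&` [set l | x < `|l|]) h = 0.
Proof.
move=> x01; set P := [set l | _].
(* Since [k l - k x] lies in [-2, 2], division by 4 keeps [u] in [0, 1]; on [Ihalf], [u < 1/2]
   exactly when |l| > x. *)
pose u (l : R) := 1 / 2 + (k l - k x) / 4.
have u01 l : 0 <= u l <= 1.
  have := cos_le1 (2 * pi * l); have := cos_geN1 (2 * pi * l).
  have := cos_le1 (2 * pi * x); have := cos_geN1 (2 * pi * x).
  by rewrite /u /k; lra.
pose U : {poly R} := (1 / 2)%:P + (1 / 4) *: ('X - (k x)%:P).
pose Q n : {poly R} := (1 - U ^+ n) ^+ (2 ^ n).
have QE n l : (Q n).[k l] = step_poly n (u l).
  rewrite /Q /step_poly horner_exp hornerD hornerN horner_exp /U !hornerE.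
  by congr ((_ - _ ^+ _) ^+ _); rewrite /u; field.
have mP : measurable P.
  rewrite (_ : P = `]x, +oo[ `|` `]-oo, - x[); first exact: measurableU.
  apply/seteqP; split => l /=; rewrite !in_itv /= andbT.
    by rewrite /P /= lter_normr => /orP[->|]; [left|rewrite ltrNr => ->; right].
  by rewrite /P /= lter_normr => -[->//|]; rewrite ltrNr => ->; rewrite orbT.
have /measurable_EFinP mh := measurable_int _ ih.
pose f_ n l := (h l * (Q n).[k l])%:E; pose f l := (h l * \1_P l)%:E.
have mf_ n : measurable_fun Ihalf (f_ n).
  apply/measurable_EFinP; apply: measurable_funM => //.
  by apply: measurable_funTS; have [] := bmeasR_poly_cos (Q n).
have mf : measurable_fun Ihalf f.
  apply/measurable_EFinP; apply: measurable_funM => //.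
have f_f : {ae mu, forall l, Ihalf l -> f_ ^~ l @ \oo --> f l}.
  exists [set x; - x]; split; first by apply: measurableU; exact: measurable_set1.
    by apply: countable_lebesgue_measure0; apply: finite_set_countable; exact: finite_set2.
  move=> l /= hl; apply: contrapT => xl; apply: hl => Il.
  suff sc : step_poly n (u l) @[n --> \oo] --> (\1_P l : R).
    apply: cvg_EFin; first exact: nearW.
    rewrite (_ : fine \o _ = fun n => h l * step_poly n (u l)).
      by apply: cvgM => //; exact: cvg_cst.
    by apply/funext => n; rewrite /= QE.
  have /andP[ul0 ul1] := u01 l; rewrite indicE.
  have [lx|lx|lx] := ltgtP `|l| x.
  - rewrite memNset; last by rewrite /P /= => /lt_trans/(_ lx); rewrite ltxx.
    apply: step_poly_cvg0; rewrite ul1 andbT.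
    have kE : k `|l| = k l by rewrite /k; case: ler0P => // _; rewrite mulrN cosN.
    have [x0 x1] := andP x01.
    have : k x < k l.
      rewrite -kE k_lt ?(ger0_norm x0) ?normr_ge0 //=; first exact: le_trans (ltW lx) x1.
      by rewrite /Defs.Ihalf /= in_itv /=; lra.
    by rewrite /u; lra.
  - rewrite mem_set//; apply: step_poly_cvg1; rewrite ul0 /=.
    have : k l < k x by rewrite k_lt.
    by rewrite /u; lra.
  - exfalso; apply: xl; have [l0|l0] := leP 0 l; [left|right] => /=.
      by rewrite -lx ger0_norm.
    by rewrite -lx ltr0_norm// opprK.
have ig : mu.-integrable Ihalf (fun l => `|h l|%:E) by exact: integrable_norm.
have f_g : {ae mu, forall l n, Ihalf l -> (`|f_ n l| <= `|h l|%:E)%E}.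
  apply: aeW => l n _; rewrite /f_ lee_fin normrM ler_piMr// QE.
  by have /andP[s0 s1] := step_poly01 n (u01 l); rewrite ger0_norm.
have [fi _ cvgI] := @dominated_convergence _ _ _ mu Ihalf mI f_ f _ mf_ mf f_f ig f_g.
have z0 n : (\int[mu]_(l in Ihalf) f_ n l = 0)%E.
  have := poly_cos_Rint (Q n); rewrite /Defs.Rint /Rintegral => h0.
  rewrite -[LHS]fineK ?h0//; apply: integrable_fin_num => //.
  by apply: integrable_mul_bmeasR => //; exact: bmeasR_poly_cos.
have If0 : (\int[mu]_(l in Ihalf) f l = 0)%E.
  rewrite -(cvg_lim _ cvgI)//; apply: lim_near_cst => //; apply: nearW => n; exact: z0.
transitivity (fine (\int[mu]_(l in Ihalf) f l)); last by rewrite If0.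
rewrite /Defs.Rint Rintegral_mkcondr; congr fine; apply: eq_integral => l _; rewrite /f patchE indicE.
by case: ifP => _; rewrite ?mulr1 ?mulr0.
Qed.

End EvenFunction.

Lemma measurable_oppT :
  measurable_fun setT (-%R : measurableTypeR R -> measurableTypeR R).
Proof. exact: oppr_measurable. Qed.

Definition opp_measure : {measure set (measurableTypeR R) -> \bar R} :=
  measure_function_pushforward__canonical__measure_function_Measure mu measurable_oppT.

Lemma lebesgue_measure_opp (A : set R) : measurable A -> mu A = opp_measure A.
Proof.
move: A; apply: lebesgue_measure_unique => _ [[a b] _ <-] /=.
rewrite /pushforward (_ : -%R @^-1` _ = `[- b, - a[%classic); last first.
  by apply/seteqP; split => x /=; rewrite !in_itv /= lerNl ltrNr andbC.
rewrite !lebesgue_measure_itv /= !lte_fin ltrN2.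
by case: ifP => // _; rewrite -!EFinB; congr (_%:E); ring.
Qed.

Lemma Rint_opp (D : set R) (f : R -> R) : measurable D ->
  mu.-integrable setT (EFin \o f) -> mu.-integrable setT (EFin \o (fun x => f (- x))) ->
  Rint D f = Rint (-%R @^-1` D) (fun x => f (- x)).
Proof.
move=> mD fi fNi; congr fine; transitivity (\int[opp_measure]_(x in D) (f x)%:E)%E.
  by apply: eq_measure_integral => A mA _; rewrite -lebesgue_measure_opp.
rewrite /opp_measure /= integral_pushforward//; first by case/integrableP : fi.
have mN : measurable ((-%R : measurableTypeR R -> measurableTypeR R) @^-1` D).
  by rewrite -[X in measurable X]setTI; exact: measurable_oppT.
exact: (@integrableS _ _ _ _ setT).
Qed.

Lemma even_Rint_opp (D : set R) (f : R -> R) : measurable D -> (forall x, f (- x) = f x) ->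
  mu.-integrable setT (EFin \o f) -> Rint D f = Rint (-%R @^-1` D) f.
Proof.
move=> mD /funext fe fi; rewrite Rint_opp ?fe//.
Qed.

Lemma Ihalf_opp (l : R) : Ihalf (- l) <-> Ihalf l.
Proof. by rewrite /Defs.Ihalf /= !in_itv /=; split; lra. Qed.

(** Extension by zero puts the function on the whole line, where [Rint_opp] applies; the integral
    then equals its own opposite. *)
Lemma odd_Rint_eq0 (f : R -> R) : (forall x, Ihalf x -> f (- x) = - f x) ->
  mu.-integrable Ihalf (EFin \o f) -> Rint Ihalf f = 0.
Proof.
move=> fodd fi; pose g := f \_ Ihalf.
have gi : mu.-integrable setT (EFin \o g).
  by move: fi; rewrite integrable_mkcond//= (restrict_EFin f).
have godd : (fun x => g (- x)) = fun x => - 1 * g x.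
  apply/funext => x; rewrite /g !patchE mulN1r; case: ifP => [/set_mem /Ihalf_opp Ix|nIx].
    by rewrite mem_set// fodd.
  rewrite ifF ?oppr0//; apply: contraFF nIx => /set_mem/Ihalf_opp Ix.
  by rewrite mem_set.
have gE : Rint Ihalf f = Rint setT g by rewrite /Defs.Rint Rintegral_mkcond.
have iN : mu.-integrable setT (EFin \o (fun x => - 1 * g x)) by exact: integrable_mulrl.
have E1 : Rint setT g = Rint setT (fun x => - 1 * g x).
  by rewrite {1}Rint_opp ?godd// preimage_setT.
have E2 : Rint setT (fun x => - 1 * g x) = - 1 * Rint setT g by exact: RintegralZl.
by rewrite gE; lra.
Qed.

(** The integral over |l| > x vanishes, and evenness makes each of its two halves vanish. So the
    primitive of the zero extension is identically zero, and Lebesgue's differentiation theorem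
    makes the function zero almost everywhere. *)
Lemma fourier_even_eq0 (h : R -> R) : mu.-integrable Ihalf (EFin \o h) ->
  (forall l, Ihalf l -> h (- l) = h l) ->
  (forall n : int, Rint Ihalf (fun l => h l * cos (2 * pi * n%:~R * l)) = 0) ->
  {ae mu, forall l, Ihalf l -> h l = 0}.
Proof.
move=> ih heven hcos; pose f := h \_ Ihalf.
have fi : mu.-integrable setT (EFin \o f).
  by move: ih; rewrite integrable_mkcond//= (restrict_EFin h).
have fiD D : measurable D -> mu.-integrable D (EFin \o f).
  by move=> mD; apply: integrableS fi.
have fe x : f (- x) = f x.
  rewrite /f !patchE; case: ifP => [/set_mem /Ihalf_opp Ix|nIx].
    by rewrite mem_set// heven.
  by rewrite ifF//; apply: contraFF nIx => /set_mem/Ihalf_opp Ix; rewrite mem_set.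
have total0 : Rint setT f = 0.
  rewrite /Defs.Rint -Rintegral_mkcond -[RHS](hcos 0); apply: eq_Rintegral => l _.
  by rewrite mulr0 mul0r cos0 mulr1.
have A0 x : 0 <= x -> Rint `]x, +oo[ f = 0 /\ Rint `]-oo, (- x)[ f = 0.
  move=> x0.
  have ref : Rint `]-oo, (- x)[ f = Rint `]x, +oo[ f.
    rewrite even_Rint_opp//; congr (Rint _ _); apply/seteqP.
    by split => l /=; rewrite !in_itv /= andbT ltrN2.
  have sum0 : Rint `]x, +oo[ f + Rint `]-oo, (- x)[ f = 0.
    rewrite /Defs.Rint -Rintegral_setU//; last 2 first.
    - by apply: fiD; exact: measurableU.
    - rewrite disj_set2E; apply/eqP/seteqP; split => // l [] /=.
      by rewrite !in_itv /= andbT; lra.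
    have UE : `]x, +oo[ `|` `]-oo, (- x)[ = [set l | x < `|l|].
      apply/seteqP; split => l /=; rewrite !in_itv /= andbT lter_normr.
        by move=> [->//|]; rewrite ltrNr => ->; rewrite orbT.
      by move=> /orP[->|]; [left|rewrite ltrNr => ->; right].
    rewrite UE; have [x1|x1] := leP x (1 / 2).
      by rewrite -Rintegral_mkcondl; apply: (outer_Rint ih hcos); rewrite x0.
    rewrite (@eq_Rintegral _ _ _ _ _ (fun=> 0)).
      rewrite Rintegral_cst ?mul0r// -UE; exact: measurableU.
    move=> l /set_mem /= xl; rewrite memNset//.
    rewrite /Defs.Ihalf /= in_itv /= => /andP[l0 l1].
    by move: xl; rewrite lter_normr; lra.
  by move: sum0; rewrite ref; split; lra.
(* For [x < 0] the ray is a left tail; otherwise it is the complement of a right tail, and the total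
   integral is the coefficient of frequency 0. *)
have F0 x : Rintegral mu `]-oo, x] f = 0.
  have [x0|x0] := ltP x 0.
    rewrite -Rintegral_itv_bndo_bndc; last exact: fiD.
    have Nx0 : 0 <= - x by lra.
    by have [_] := A0 _ Nx0; rewrite opprK.
  have [ax _] := A0 x x0; move: total0.
  rewrite (_ : setT = `]-oo, x] `|` `]x, +oo[); last first.
    apply/seteqP; split => // l _ /=; rewrite !in_itv /= andbT.
    by case: (leP l x); [left|right].
  rewrite /Defs.Rint Rintegral_setU//.
  - by rewrite [X in _ + X]ax addr0.
  - by apply: fiD; exact: measurableU.
  - rewrite disj_set2E; apply/eqP/seteqP; split => // l [] /=.
    by rewrite !in_itv /= andbT; lra.
have loc : locally_integrable setT f.
  exact: integrable_locally.
have := FTC1Ny (fun y => fiD _ (measurable_itv _)) loc.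
apply: filterS; first exact: (ae_filter_ringOfSetsType mu).
move=> l [_]; rewrite (_ : (fun x => _) = cst 0); last by apply/funext => x; exact: F0.
rewrite derive1_cst /f patchE => + Il.
by rewrite mem_set.
Qed.

End FourierUniqueness.

(** * Data spectra, their Toeplitz matrices and their Fourier series *)

Section Spectra.
Variable R : realType.
Local Notation C := (R[i]).
Local Notation mu := (@lebesgue_measure R).

Let mI := @measurable_Ihalf R.
Hint Resolve mI : core.

(** The part of [admissible] that speaks of the spectrum alone. It includes the zero spectrum, which
    stands for an absent second user. *)
Definition spectrum (S : R -> R) :=
  [/\ forall l, Ihalf l -> 0 <= S l, forall l, Ihalf l -> S (- l) = S l,
      mu.-integrable Ihalf (EFin \o S) & abs_summable_Z (rcoef S)].

Lemma rcoef0 (n : int) : rcoef (fun _ : R => 0) n = 0.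
Proof.
apply: complex_ext; rewrite /= /Defs.Rint;
  by under eq_Rintegral do rewrite mul0r; rewrite Rintegral_cst// mul0r.
Qed.

Lemma spectrum0 : spectrum (fun=> 0).
Proof.
split => //; first exact: integrable0.
by rewrite (funext rcoef0); exact: abs_summable0.
Qed.

Lemma cintegrable_weighted (S : R -> R) (f : R -> C) : mu.-integrable Ihalf (EFin \o S) ->
  bmeas f -> cintegrable Ihalf (fun l => rC (S l) * f l).
Proof.
move=> iS mf; split; under eq_fun do rewrite ReImE /= mul0r ?subr0 ?addr0.
  by apply: integrable_mul_bmeasR => //; exact: bmeas_Re.
by apply: integrable_mul_bmeasR => //; exact: bmeas_Im.
Qed.

Lemma rcoef_cintegral (S : R -> R) (n : int) :
  rcoef S n = cintegral Ihalf (fun l => rC (S l) * expj (2 * pi * l * n%:~R)).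
Proof.
by apply: complex_ext => /=; congr (Rint _ _); apply/funext => l; rewrite mul0r ?subr0 ?addr0.
Qed.

Lemma Im_rcoef (S : R -> R) (n : int) : spectrum S -> Im (rcoef S n) = 0.
Proof.
move=> [_ Se iS _] /=; apply: odd_Rint_eq0.
  by move=> l Il; rewrite Se// mulrN mulNr sinN mulrN.
by apply: integrable_mul_bmeasR => //; exact: (bmeas_Im (bmeas_expjZ R n)).
Qed.

Definition data_coef (S1 S2 : R -> R) (u v : 'I_2) (n : int) : C :=
  if u == v then (if u == 0 then rcoef S1 n else rcoef S2 n) else 0.

Lemma RtildeN_btoep S1 S2 N : RtildeN S1 S2 N = btoep (data_coef S1 S2) N.
Proof.
by rewrite /RtildeN /btoep; congr block_mx; apply/matrixP => i j; rewrite !mxE.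
Qed.

Lemma summable_data_coef S1 S2 : spectrum S1 -> spectrum S2 ->
  forall u v, abs_summable_Z (data_coef S1 S2 u v).
Proof.
move=> [_ _ _ s1] [_ _ _ s2] u v; rewrite /data_coef.
case: (u == v); last exact: abs_summable0.
by case: (u == 0).
Qed.

Lemma psdmxD n (A B : 'M[C]_n) : psdmx A -> psdmx B -> psdmx (A + B).
Proof.
by move=> pA pB v; rewrite mulmxDr mulmxDl mxE addr_ge0.
Qed.

(** One weighted Gram matrix per user, built from exponentials that vanish outside the user's block;
    the sum of the two has no cross terms. *)
Lemma psd_data_coef S1 S2 N : spectrum S1 -> spectrum S2 ->
  psdmx (btoep (data_coef S1 S2) N).
Proof.
move=> sp1 sp2.
pose S (u : 'I_2) := if u == 0 then S1 else S2.
have spS u : spectrum (S u) by rewrite /S; case: ifP.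
pose f (w : 'I_2) (l : R) : 'I_(N + N) -> C := unblk (fun u (i : 'I_N) =>
  if u == w then expj (2 * pi * l * (i%:Z)%:~R) else 0).
pose M (w : 'I_2) : 'M[C]_(N + N) := \matrix_(a, b)
  cintegral Ihalf (fun l => rC (S w l) * (f w l a * Defs.conjc (f w l b))).
have pM w : psdmx (M w).
  have [S0 _ iS _] := spS w.
  apply: psd_cintegral => // [a b|l Il]; last exact: psd_rank1 (S0 l Il).
  apply: cintegrable_weighted => //.
  have [u [i ->]] := blk_exists a; have [v [j ->]] := blk_exists b.
  rewrite (_ : (fun l => _) = fun l =>
    (if u == w then expj (2 * pi * l * (i%:Z)%:~R) else 0) *
    Defs.conjc (if v == w then expj (2 * pi * l * (j%:Z)%:~R) else 0)); last first.
    by apply/funext => l; rewrite /f !unblkE.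
  have conj_bmeas (g : R -> C) : bmeas g -> bmeas (fun l => Defs.conjc (g l)).
    move=> [g1 g2 [K gK]]; split => //=; first exact: measurableT_comp.
    by exists K => l; rewrite cabs_conj.
  apply: bmeasM; last apply: conj_bmeas.
    by case: (u == w); [exact: bmeas_expjZ|exact: bmeas_cst].
  by case: (v == w); [exact: bmeas_expjZ|exact: bmeas_cst].
have -> : btoep (data_coef S1 S2) N = M 0 + M 1; last exact: psdmxD.
apply/matrixP => a b.
have [u [i ->]] := blk_exists a; have [v [j ->]] := blk_exists b.
rewrite btoepE !mxE /f.
have E0 w : (u == w) && (v == w) = false -> cintegral Ihalf (fun l => rC (S w l) *
   (unblk (fun u (i : 'I_N) => if u == w then expj (2 * pi * l * (i%:Z)%:~R) else 0) (blk u i) *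
    Defs.conjc (unblk (fun u (i : 'I_N) => if u == w then expj (2 * pi * l * (i%:Z)%:~R) else 0)
      (blk v j)))) = 0.
  have c0 : Defs.conjc (0 : C) = 0 by apply: complex_ext; rewrite /= ?oppr0.
  move=> uw; rewrite -[RHS](cintegral0 mI); apply: eq_cintegral => l; rewrite !unblkE.
  by move: uw; case: (u == w); case: (v == w) => //=; rewrite ?c0 ?mul0r ?mulr0.
have E1 w : u = w -> v = w -> cintegral Ihalf (fun l => rC (S w l) *
   (unblk (fun u (i : 'I_N) => if u == w then expj (2 * pi * l * (i%:Z)%:~R) else 0) (blk u i) *
    Defs.conjc (unblk (fun u (i : 'I_N) => if u == w then expj (2 * pi * l * (i%:Z)%:~R) else 0)
      (blk v j)))) = rcoef (S w) (i%:Z - j%:Z).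
  move=> -> ->; rewrite rcoef_cintegral; apply: eq_cintegral => l; rewrite !unblkE eqxx.
  by rewrite -expjN -expjD; congr (_ * expj _); rewrite rmorphB /=; ring.
rewrite /data_coef; case: (ord2P u) (ord2P v) => eu [] ev.
- by rewrite E1// E0 ?eu ?ev//= addr0.
- by rewrite !E0 ?eu ?ev//= addr0.
- by rewrite !E0 ?eu ?ev//= addr0.
- by rewrite E0 ?E1 ?eu ?ev//= add0r.
Qed.

(** Both functions are even, and by [fourier_coef_symb] they have the same cosine coefficients.
    Positivity of the series enters through its reality. *)
Lemma spectrum_symb_ae S : spectrum S ->
  (forall l, 0 <= symb (rcoef S) l) ->
  {ae mu, forall l, Ihalf l -> S l = Re (symb (rcoef S) l)}.
Proof.
move=> sp symb0; have [S0 Se iS sS] := sp.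
have Im0 l : Im (symb (rcoef S) l) = 0.
  by have := symb0 l; rewrite lecE /= => /andP[/eqP].
have ms := bmeas_symb sS.
have isym : mu.-integrable Ihalf (EFin \o (fun l => Re (symb (rcoef S) l))).
  by apply: bmeasR_integrable; exact: bmeas_Re.
have := @fourier_even_eq0 R (fun l => S l - Re (symb (rcoef S) l)).
move=> /(_ (integrable_subr mI iS isym)) H.
have : {ae mu, forall l, Ihalf l -> S l - Re (symb (rcoef S) l) = 0}.
  apply: H => [l Il|n].
    rewrite Se//; congr (_ - _).
    have ReE x : Re (symb (rcoef S) x) =
      zsumR (fun n => Re (rcoef S n * expj (2 * pi * x * n%:~R))) by [].
    rewrite !ReE; congr zsumR; apply/funext => n; rewrite !RecM Im_rcoef// !mul0r.
    by congr (_ * _ - _); rewrite /= mulrN mulNr cosN.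
  have cosE l : cos (2 * pi * n%:~R * l) = cos (2 * pi * l * n%:~R) :> R by rewrite mulrAC.
  have cb : bmeasR (fun l : R => cos (2 * pi * l * n%:~R)) := bmeas_Re (bmeas_expjZ R n).
  transitivity (Rint Ihalf (fun l => S l * cos (2 * pi * l * n%:~R)) -
     Rint Ihalf (fun l => Re (symb (rcoef S) l) * cos (2 * pi * l * n%:~R))).
    rewrite /Defs.Rint -RintegralB//; [|exact: integrable_mul_bmeasR|exact: integrable_mul_bmeasR].
    by apply: eq_Rintegral => l _; rewrite cosE mulrBl.
  have FC : Rint Ihalf (fun l => Re (symb (rcoef S) l * expj (- (2 * pi * l * n%:~R)))) =
    Rint Ihalf (fun l => S l * cos (2 * pi * l * n%:~R)).
    exact: (congr1 (@complex.Re R) (fourier_coef_symb n sS)).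
  rewrite -FC.
  apply/eqP; rewrite subr_eq0; apply/eqP; congr (Rint _ _); apply/funext => l.
  by rewrite RecM Im0 mul0r subr0 /= cosN.
apply: filterS; first exact: (ae_filter_ringOfSetsType mu).
by move=> l h Il; apply/eqP; rewrite -subr_eq0 h.
Qed.

End Spectra.

(** * The Szegő limit for products of block Toeplitz matrices *)

Section SzegoLimit.
Variable R : realType.
Local Notation C := (R[i]).
Local Notation mu := (@lebesgue_measure R).

Let mI := @measurable_Ihalf R.
Hint Resolve mI : core.

Lemma row_sum_mulmx n (A B : 'M[C]_n) (a b : R) : 0 <= b ->
  (forall i, \sum_j cabs (A i j) <= a) -> (forall i, \sum_j cabs (B i j) <= b) ->
  forall i, \sum_j cabs ((A *m B) i j) <= a * b.
Proof.
move=> b0 Aa Bb i.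
apply: (@le_trans _ _ (\sum_j \sum_k cabs (A i k) * cabs (B k j))).
  apply: ler_sum => j _; rewrite mxE; apply: le_trans (cabs_sum _ _ _) _.
  by apply: ler_sum => k _; rewrite cabsM.
rewrite exchange_big /=; apply: (@le_trans _ _ (\sum_k cabs (A i k) * b)).
  by apply: ler_sum => k _; rewrite -mulr_sumr ler_wpM2l ?cabs_ge0.
by rewrite -mulr_suml ler_wpM2r.
Qed.

(** One constant for the matrices and the symbol puts all eigenvalues in one interval, so that one
    polynomial serves both. The factor 2 in its construction is that of [symb_bound]. *)
Lemma row_sum_btoep_bsymb (a : 'I_2 -> 'I_2 -> int -> C) : (forall u v, abs_summable_Z (a u v)) ->
  exists A : R, [/\ 0 <= A, forall N p, \sum_q cabs (btoep a N p q) <= A &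
                   forall l u, \sum_v cabs (bsymb a l u v) <= A].
Proof.
move=> sa.
have /choice[A1 hA1] : forall uv : 'I_2 * 'I_2, exists A, forall N,
    psum (fun n => cabs (a uv.1 uv.2 n)) N <= A by move=> [u v]; exact: sa.
have A10 uv : 0 <= A1 uv.
  by apply: le_trans (hA1 uv 0%N); apply: psum_ge0 => n; exact: cabs_ge0.
pose A := \sum_uv 2 * A1 uv.
have rowA u : \sum_(v < 2) 2 * A1 (u, v) <= A.
  have -> : A = \sum_(u < 2) \sum_(v < 2) 2 * A1 (u, v).
    by rewrite pair_bigA; apply: eq_bigr => -[].
  rewrite [leRHS](bigD1 u)//= lerDl; apply: sumr_ge0 => w _; apply: sumr_ge0 => v _.
  exact: mulr_ge0.
have A0 : 0 <= A by apply: sumr_ge0 => uv _; exact: mulr_ge0.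
exists A; split => // [N p|l u].
- have [u [i ->]] := blk_exists p; rewrite sum_blk; apply: le_trans (rowA u).
  apply: ler_sum => v _; under eq_bigr do rewrite btoepE.
  apply: (@le_trans _ _ (A1 (u, v))); last by rewrite ler_peMl//; lra.
  apply: le_trans (hA1 (u, v) N) => /=.
  by apply: (sum_shift_le (b := fun n => cabs (a u v n))) => // n; exact: cabs_ge0.
- apply: le_trans (rowA u); apply: ler_sum => v _; rewrite mxE.
  exact: (symb_bound l (hA1 (u, v))).
Qed.

Lemma det22 (A : 'M[C]_2) : \det A = A 0 0 * A 1 1 - A 0 1 * A 1 0.
Proof.
rewrite (expand_det_row _ 0) !big_ord_recl big_ord0 addr0 /cofactor !det_mx11 !mxE /=.
have l0 : lift (0 : 'I_2) (0 : 'I_1) = 1 by exact/val_inj.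
have l1 : lift (1 : 'I_2) (0 : 'I_1) = 0 by exact/val_inj.
have l00 : lift ord0 ord0 = 1 :> 'I_2 by exact/val_inj.
have o0 : ord0 = 0 :> 'I_2 by exact/val_inj.
rewrite ?l00 ?o0 ?l0 ?l1 /=.
by rewrite expr0 expr1 mul1r mulN1r mulrN.
Qed.

(* The eigenvalues lie in [0, A B], where ln (1 + c x) is a uniform limit of
   polynomials; for polynomials the claim is trace_cvg. *)
Lemma block_szego (a b : 'I_2 -> 'I_2 -> int -> C) (c : R) : 0 < c ->
  (forall u v, abs_summable_Z (a u v)) -> (forall u v, abs_summable_Z (b u v)) ->
  (forall N, ctr (btoep a N) = btoep a N) ->
  (forall N, psdmx (btoep a N)) -> (forall N, psdmx (btoep b N)) ->
  let L l := ln (Re (\det (1%:M + rC c *: (bsymb a l *m bsymb b l)))) in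
  bmeasR L /\
  (N%:R^-1 * ln (Re (\det (1%:M + rC c *: (btoep a N *m btoep b N))))) @[N --> \oo] -->
  Rint Ihalf L.
Proof.
move=> c0 sa sb ha pa pb Lf.
have psa l := psd_bsymb l sa pa; have psb l := psd_bsymb l sb pb.
have [A [A0 At As]] := row_sum_btoep_bsymb sa.
have [B [B0 Bt Bs]] := row_sum_btoep_bsymb sb.
have hsa l : ctr (bsymb a l) = bsymb a l by have [] := psd2_herm (psa l).
pose M N := btoep a N *m btoep b N; pose F l := bsymb a l *m bsymb b l.
have eigM N (v : 'rV[C]_(N + N)) z : v != 0 -> v *m M N = z *: v -> 0 <= z /\ cabs z <= A * B.
  move=> v0 vz; split; first exact: (eigen_psd_mul (ha N) (pa N) (pb N) v0 vz).
  by apply: (eigen_row_sum _ v0 vz); exact: row_sum_mulmx.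
have eigF l (v : 'rV[C]_2) z : v != 0 -> v *m F l = z *: v -> 0 <= z /\ cabs z <= A * B.
  move=> v0 vz; split; first exact: (eigen_psd_mul (hsa l) (psa l) (psb l) v0 vz).
  by apply: (eigen_row_sum _ v0 vz); exact: row_sum_mulmx.
have asX k := asymp_symbolX k sa sb.
have bmX k u v : bmeas (fun l => (F l ^+ k) u v) by have [] := asX k.
have bmtr k : bmeas (fun l => \tr (F l ^+ k)) by exact: bmeas_sum.
have bmp p : bmeas (fun l => trpoly p (F l)).
  by apply: bmeas_sum => k; apply: bmeasM => //; exact: bmeas_cst.
have bmF u v : bmeas (fun l => (1%:M + rC c *: F l) u v).
  under eq_fun do rewrite mxE [X in _ + X]mxE.
  apply: bmeasD; first exact: bmeas_cst.
  by apply: bmeasM; [exact: bmeas_cst|have := bmX 1%N u v; under eq_fun do rewrite expr1].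
have mL : measurable_fun setT Lf.
  apply: (measurableT_comp (@measurable_ln R)).
  have [] // : bmeas (fun l => \det (1%:M + rC c *: F l)).
  under eq_fun do rewrite det22 -mulN1r.
  by apply: bmeasD; [exact: bmeasM|apply: bmeasM; [exact: bmeas_cst|exact: bmeasM]].
have AB0 : 0 <= A * B by exact: mulr_ge0.
have approx e : 0 < e -> exists p : {poly R},
  (forall N, `|ln (Re (\det (1%:M + rC c *: M N))) - Re (trpoly p (M N))| <= (N + N)%:R * e) /\
  (forall l, `|Lf l - Re (trpoly p (F l))| <= 2 * e).
  move=> e0; have [p hp] := ln_poly_approx c0 AB0 e0; exists p; split => [N|l].
    exact: (logdet_trpoly (ltW c0) (@eigM N) hp).
  exact: (logdet_trpoly (ltW c0) (@eigF l) hp).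
(* Boundedness is inherited from a polynomial approximation with parameter 1. *)
have bmL : bmeasR Lf.
  split => //; have [p [_ hp]] := approx 1 ltr01; have [_ [K hK]] := bmeas_Re (bmp p).
  exists (2 * 1 + K) => l; rewrite -[Lf l](subrK (Re (trpoly p (F l)))).
  by apply: le_trans (ler_normD _ _) _; apply: lerD.
(* The five shares: two for the 2x2 symbol, one for the convergence of traces, two for a matrix of
   size [2 N] divided by [N]. *)
split => //; apply/cvgrPdist_le => e e0; pose e1 := e / 5.
have e10 : 0 < e1 by rewrite /e1; lra.
have [p [hpM hpF]] := approx e1 e10.
have cvgp : cvgC (fun N => rC (N%:R^-1) * trpoly p (M N)) (cint (fun l => trpoly p (F l))).
  rewrite (_ : cint _ = \sum_(k < size p) rC p`_k * cint (fun l => \tr (F l ^+ k))).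
    apply: (@eq_cvgC _ (fun N => \sum_(k < size p) rC p`_k * (rC (N%:R^-1) * \tr (M N ^+ k)))).
      by move=> N; rewrite /trpoly mulr_sumr; apply: eq_bigr => k _; rewrite mulrCA.
    by apply: cvgC_sum => k; apply: cvgCZ; exact: trace_cvg (asX k).
  rewrite /trpoly cint_sum; first by apply: eq_bigr => k _; rewrite cintZ.
  by move=> k; apply: bmeasM => //; exact: bmeas_cst.
have [N0 hN0] := cvgp e1 e10.
exists (maxn N0 1) => // N /=; rewrite geq_max => /andP[NN0 N1].
have N00 : 0 < N%:R :> R by rewrite ltr0n.
have h1 : `|Rint Ihalf Lf - Re (cint (fun l => trpoly p (F l)))| <= 2 * e1.
  have i1 := bmeasR_integrable bmL.
  have i2 := bmeasR_integrable (bmeas_Re (bmp p)).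
  rewrite /= /Defs.Rint -RintegralB//; apply: Rint_le_bound; first exact: integrable_subr.
  by move=> l _; exact: hpF.
have h2 : `|Re (cint (fun l => trpoly p (F l))) - N%:R^-1 * Re (trpoly p (M N))| <= e1.
  have := le_trans (Re_cabs _) (hN0 N NN0).
  by rewrite RecB RecM /= mul0r subr0 distrC.
have h3 : `|N%:R^-1 * Re (trpoly p (M N)) - N%:R^-1 * ln (Re (\det (1%:M + rC c *: M N)))| <= 2 * e1.
  rewrite -mulrBr normrM ger0_norm ?invr_ge0 ?ler0n// distrC ler_pdivrMl//.
  by apply: le_trans (hpM N) _; rewrite natrD; lra.
apply: le_trans (ler_distD (Re (cint (fun l => trpoly p (F l)))) _ _) _.
apply: le_trans (lerD h1 (ler_distD (N%:R^-1 * Re (trpoly p (M N))) _ _)) _.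
apply: le_trans (lerD (lexx _) (lerD h2 h3)) _.
by rewrite /e1; lra.
Qed.

End SzegoLimit.

(** * The pulse matrices, the 2x2 determinant and the rate limits *)

Section Pulse.
Variable R : realType.
Local Notation C := (R[i]).
Local Notation mu := (@lebesgue_measure R).

Let mI := @measurable_Ihalf R.
Hint Resolve mI : core.

(** The window {-N, ..., N-1} is not symmetric under reflection: index 0 moves to the other
    half-sum, which the extra [cabs (a 0)] pays for. *)
Lemma abs_summable_conj_opp (a : int -> C) : abs_summable_Z a ->
  abs_summable_Z (fun n => Defs.conjc (a (- n))).
Proof.
move=> [M aM]; exists (cabs (a 0) + M) => N.
under eq_bigr do rewrite !cabs_conj opprK.
apply: (@le_trans _ _ (cabs (a 0) + psum (fun n => cabs (a n)) N.+1)); last first.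
  by rewrite lerD2l; exact: aM.
rewrite /psum !big_split /= addrCA addrC; apply: lerD.
  by rewrite [leRHS]big_ord_recl /= lerDr cabs_ge0.
apply: (@le_trans _ _ (\sum_(i < N.+1) cabs (a (- i%:Z)))).
  by rewrite [leRHS]big_ord_recr /= lerDl cabs_ge0.
rewrite big_ord_recl /= oppr0 lerD2l [leRHS]big_ord_recr /= lerDl cabs_ge0//.
Qed.

Definition pulse_coef (g : R -> C) (delta T tau1 tau2 : R) (u v : 'I_2) (n : int) : C :=
  if u == v then g (n%:~R * delta * T)
  else if u == 0 then g (n%:~R * delta * T + (tau1 - tau2))
  else Defs.conjc (g ((- n)%:~R * delta * T + (tau1 - tau2))).

Lemma GtildeN_btoep g delta T tau1 tau2 N :
  GtildeN g delta T tau1 tau2 N = btoep (pulse_coef g delta T tau1 tau2) N.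
Proof.
rewrite /GtildeN /btoep; congr block_mx; apply/matrixP => i j; rewrite !mxE//.
by rewrite /pulse_coef /= opprB.
Qed.

Lemma summable_pulse_coef g delta T tau1 tau2 :
  abs_summable_Z (fun n => g (n%:~R * delta * T)) ->
  abs_summable_Z (fun n => g (n%:~R * delta * T + (tau1 - tau2))) ->
  forall u v, abs_summable_Z (pulse_coef g delta T tau1 tau2 u v).
Proof.
move=> s1 s2 u v; rewrite /pulse_coef; case: (u == v) => //; case: (u == 0) => //.
exact: (abs_summable_conj_opp s2).
Qed.

Lemma bsymb_pulse g delta T tau1 tau2 l :
  [/\ bsymb (pulse_coef g delta T tau1 tau2) l 0 0 = Gdelta g delta T l,
      bsymb (pulse_coef g delta T tau1 tau2) l 1 1 = Gdelta g delta T l &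
      bsymb (pulse_coef g delta T tau1 tau2) l 0 1 = G12delta g delta T tau1 tau2 l].
Proof. by split; rewrite mxE. Qed.

Lemma bsymb_data S1 S2 (l : R) :
  [/\ bsymb (data_coef S1 S2) l 0 0 = symb (rcoef S1) l,
      bsymb (data_coef S1 S2) l 1 1 = symb (rcoef S2) l,
      bsymb (data_coef S1 S2) l 0 1 = 0 & bsymb (data_coef S1 S2) l 1 0 = 0].
Proof.
have symb0 : symb (fun _ : int => 0 : C) l = 0.
  by rewrite -[RHS](zsumC0 R) /symb; congr zsumC; apply/funext => n; rewrite mul0r.
by split; rewrite mxE.
Qed.

Section Autocorrelation.
Variables pr pim : R -> R.
Hypotheses (mpr : measurable_fun setT pr) (mpi : measurable_fun setT pim).
Hypotheses (pr2 : mu.-integrable setT (fun s => (pr s ^+ 2)%:E))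
           (pi2 : mu.-integrable setT (fun s => (pim s ^+ 2)%:E)).
Variables delta T tau1 tau2 : R.
Let g := autocorr pr pim.

(** The times are the receiver's sampling instants, multiples of [delta * T] delayed by [tau1] or
    [tau2]. *)
Lemma pulse_btoep_gram N : exists t : 'I_(N + N) -> R,
  btoep (pulse_coef g delta T tau1 tau2) N = \matrix_(p, q) g (t p - t q).
Proof.
pose t : 'I_(N + N) -> R := unblk (fun u (i : 'I_N) =>
  (i%:Z)%:~R * delta * T + (if u == 0 then tau1 else tau2)).
exists t; apply/matrixP => p q.
have [u [i ->]] := blk_exists p; have [v [j ->]] := blk_exists q.
rewrite btoepE mxE /t !unblkE /pulse_coef.
case: (ord2P u) => ->; case: (ord2P v) => -> /=; rewrite -?autocorrN//;
  by congr g; rewrite ?opprB !rmorphB /=; ring.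
Qed.

Lemma psd_pulse_btoep N : psdmx (btoep (pulse_coef g delta T tau1 tau2) N).
Proof. by have [t ->] := pulse_btoep_gram N; exact: psd_autocorr. Qed.

Lemma herm_pulse_btoep N : let A := btoep (pulse_coef g delta T tau1 tau2) N in ctr A = A.
Proof.
have [t ->] := pulse_btoep_gram N; apply/matrixP => p q.
by rewrite !mxE -autocorrN// opprB.
Qed.

Hypotheses (sg : abs_summable_Z (fun n => g (n%:~R * delta * T)))
           (sg12 : abs_summable_Z (fun n => g (n%:~R * delta * T + (tau1 - tau2)))).

Let a := pulse_coef g delta T tau1 tau2.
Let G l := Re (Gdelta g delta T l).
Let H l := G12delta g delta T tau1 tau2 l.

(** Where [G] vanishes, the first basis vector has zero quadratic form, so [psdmx_ker] annihilates
    the whole first row of the symbol, including [H]. *)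
Lemma pulse_symbol l : [/\ Gdelta g delta T l = rC (G l),
  bsymb a l 1 0 = Defs.conjc (H l) & (G l = 0 -> H l = 0)].
Proof.
have psa := psd_bsymb l (summable_pulse_coef sg sg12) psd_pulse_btoep.
have [a0 _ a10 hA] := psd2_herm psa; have [e00 _ e01] := bsymb_pulse g delta T tau1 tau2 l.
have GE : Gdelta g delta T l = rC (G l).
  by move: a0; rewrite e00 lecE /= => /andP[/eqP i0 _]; apply: complex_ext.
split => //; first by rewrite a10 e01.
move=> G0; pose e : 'rV[C]_2 := delta_mx 0 0.
have eA : e *m bsymb a l = row 0 (bsymb a l) by rewrite rowE.
have v0 : (e *m bsymb a l *m ctr e) 0 0 = 0.
  have cE : ctr e = delta_mx 0 0.
    apply/matrixP => i j; rewrite !mxE andbC.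
    by case: (_ && _); apply: complex_ext; rewrite /= ?oppr0.
  by rewrite cE -colE eA [LHS]mxE [LHS]mxE e00 GE G0.
have := psdmx_ker hA psa v0; rewrite eA => /rowP/(_ 1).
by rewrite [LHS]mxE [RHS]mxE -/a e01.
Qed.

(** Written with [G l ^+ 2 - cnorm2 (H l)] in place of the quotient, the formula holds at the zeros
    of [G] as well. *)
Lemma det_symbol (c : R) S1 S2 l :
  (forall k, 0 <= symb (rcoef (if k then S1 else S2)) l) ->
  let s k := Re (symb (rcoef (if k then S1 else S2)) l) in
  Re (\det (1%:M + rC c *: (bsymb a l *m bsymb (data_coef S1 S2) l))) =
  1 + c * (G l * s true) + c * (G l * s false) +
  c ^+ 2 * (s true * s false * (G l ^+ 2 - cnorm2 (H l))).
Proof.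
move=> s0 s; have [GE a10 _] := pulse_symbol l.
have [e00 e11 e01] := bsymb_pulse g delta T tau1 tau2 l.
have [d00 d11 d01 d10] := bsymb_data S1 S2 l.
have sE k : symb (rcoef (if k then S1 else S2)) l = rC (s k).
  by have := s0 k; rewrite lecE /= => /andP[/eqP i0 _]; apply: complex_ext.
have prodE u v : (1%:M + rC c *: (bsymb a l *m bsymb (data_coef S1 S2) l)) u v =
  (u == v)%:R + rC c * (bsymb a l u 0 * bsymb (data_coef S1 S2) l 0 v +
                        bsymb a l u 1 * bsymb (data_coef S1 S2) l 1 v).
  rewrite mxE [X in _ + X]mxE mxE [X in _ * X]mxE !big_ord_recl big_ord0 addr0.
  by congr (_ + _ * (_ * _ + _ * _)); congr fun_of_matrix; exact/val_inj.
rewrite det22 !prodE /= d00 d11 d01 d10 -/a e00 e11 e01 a10 (sE true) (sE false) GE.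
rewrite -/(H l) !mulr0 !addr0 !add0r.
have detE (k x y z h h' : C) :
  (1 + k * (z * x)) * (1 + k * (z * y)) - k * (h * y) * (k * (h' * x)) =
  1 + k * (z * x) + k * (z * y) + k ^+ 2 * (x * y * (z ^+ 2 - h * h')) by ring.
have HE : H l * Defs.conjc (H l) = rC (cnorm2 (H l)).
  by rewrite mulC_conj /cabs sqr_sqrtr// addr_ge0 ?sqr_ge0.
rewrite detE HE !expr2 -!rCM -!rCN -!rCD -!rCM.
by rewrite !RecD.
Qed.

(** [block_szego] yields the limit in terms of the Fourier series of the spectra; [spectrum_symb_ae]
    then replaces them by the spectra under the integral. *)
Lemma ratesum_cvg (s2 : R) S1 S2 : 0 < s2 -> spectrum S1 -> spectrum S2 ->
  ratesum_N g delta T tau1 tau2 s2 S1 S2 @ \oo --> int_ratesum g delta T tau1 tau2 s2 S1 S2.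
Proof.
move=> s20 sp1 sp2; pose c := s2^-1; pose b := data_coef S1 S2.
have c0 : 0 < c by rewrite invr_gt0.
have sa := summable_pulse_coef sg sg12; have sb := summable_data_coef sp1 sp2.
have pb N : psdmx (btoep b N) by exact: psd_data_coef.
have /= := block_szego c0 sa sb herm_pulse_btoep psd_pulse_btoep pb.
set Lf := (X in bmeasR X); set X := (X in X @ _ --> _) => -[bmL cvgX].
set L := Rint Ihalf Lf in cvgX.
have -> : ratesum_N g delta T tau1 tau2 s2 S1 S2 = fun N => 2^-1 / ln 2 * X N.
  apply/funext => N; rewrite /ratesum_N /nlogdet /X GtildeN_btoep RtildeN_btoep /log2 invfM.
  by rewrite -/c; ring.
have -> : int_ratesum g delta T tau1 tau2 s2 S1 S2 = 2^-1 / ln 2 * L; last first.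
  by apply: cvgM => //; exact: cvg_cst.
have psb l := psd_bsymb l sb pb.
pose S (k : bool) := if k then S1 else S2.
have spS k : spectrum (S k) by case: k.
have symb0 k l : 0 <= symb (rcoef (S k)) l.
  have [h0 h1 _ _] := psd2_herm (psb l); have [d0 d1 _ _] := bsymb_data S1 S2 l.
  by case: k; [rewrite -d0|rewrite -d1].
have aeS k := spectrum_symb_ae (spS k) (symb0 k).
pose phi (x y l : R) := 1 + c * (G l * x) + c * (G l * y) +
  c ^+ 2 * (x * y * (G l ^+ 2 - cnorm2 (H l))).
have mG : measurable_fun setT G by have [] := bmeas_symb sg.
have mHn : measurable_fun setT (fun l => cnorm2 (H l)).
  have [h1 h2 _] := bmeas_symb sg12.
  by apply: measurable_funD; exact: measurable_funX.
have mphi (x y : R -> R) : measurable_fun Ihalf x -> measurable_fun Ihalf y ->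
  measurable_fun Ihalf (fun l => ln (phi (x l) (y l) l)).
  move=> mx my; apply: (measurableT_comp (@measurable_ln R)).
  have mGI : measurable_fun Ihalf G by exact: measurable_funTS.
  have mHI : measurable_fun Ihalf (fun l => cnorm2 (H l)) by exact: measurable_funTS.
  apply: measurable_funD; last first.
    apply: measurable_funM; first exact: measurable_cst.
    apply: measurable_funM; first exact: measurable_funM.
    by apply: measurable_funB => //; exact: measurable_funX.
  apply: measurable_funD.
    apply: measurable_funD; first exact: measurable_cst.
    by apply: measurable_funM; [exact: measurable_cst|exact: measurable_funM].
  by apply: measurable_funM; [exact: measurable_cst|exact: measurable_funM].
have mS k : measurable_fun Ihalf (S k).
  by have [_ _ iS _] := spS k; apply/measurable_EFinP; exact: measurable_int iS.
have lnE l : Ihalf l -> log2 (1 + s2^-1 * Seff g delta T S1 l + s2^-1 * Seff g delta T S2 l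
  + s2^-2 * Seff g delta T S1 l * Seff g delta T S2 l
  * (1 - cnorm2 (G12delta g delta T tau1 tau2 l) / (Re (Gdelta g delta T l)) ^+ 2)) =
  (ln 2)^-1 * ln (phi (S1 l) (S2 l) l).
  move=> Il; rewrite /log2 mulrC; congr (_ * ln _); rewrite /Seff /phi -/(G l) -/(H l) -/c.
  congr (_ + _); rewrite -exprVn -/c; have [G0|G0] := eqVneq (G l) 0.
    (* At a zero of [G] the rate formula loses its last term through [Seff], whereas the determinant
       keeps a multiple of [cnorm2 (H l)], which vanishes here. *)
    have [_ _ /(_ G0) ->] := pulse_symbol l.
    by rewrite G0 /cnorm2 /=; ring.
  by field.
rewrite /int_ratesum -mulrA; congr (_ * _).
rewrite /L /Defs.Rint -RintegralZl//; last exact: bmeasR_integrable.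
have detE l : Lf l = ln (phi (Re (symb (rcoef (S true)) l)) (Re (symb (rcoef (S false)) l)) l).
  by congr ln; apply: det_symbol => k; exact: symb0.
transitivity (Rintegral mu Ihalf (fun l => (ln 2)^-1 * ln (phi (S1 l) (S2 l) l))).
  by apply: eq_Rintegral => l /set_mem Il; exact: lnE.
congr fine; apply: ae_eq_integral => //.
- by apply/measurable_EFinP; apply: measurable_funM => //; exact: mphi (mS true) (mS false).
- apply/measurable_EFinP; apply: measurable_funM => //.
  by apply: measurable_funTS; have [] := bmL.
- have := aeS true; have := aeS false.
  apply: filterS2; first exact: (ae_filter_ringOfSetsType mu).
  by move=> l h2 h1 Il /=; have := detE l; rewrite -h1// -h2// => <-.
Qed.

(** With a zero second data block the matrix is block lower triangular with an identity block in the
    corner. *)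
Lemma ratesum_N0 s2 S1 : ratesum_N g delta T tau1 tau2 s2 S1 (fun=> 0) = rate1_N g delta T s2 S1.
Proof.
apply/funext => N; rewrite /ratesum_N /rate1_N /nlogdet; congr (_ * log2 (Re _)).
have R0 : RN (fun=> 0 : R) N = 0 by apply/matrixP => i j; rewrite !mxE rcoef0.
rewrite /GtildeN /RtildeN R0 mulmx_block !mulmx0 !addr0 scale_block_mx !scaler0.
rewrite (scalar_mx_block N N 1) add_block_mx !addr0 det_lblock det1 mulr1.
by [].
Qed.

Lemma int_ratesum0 s2 S1 :
  int_ratesum g delta T tau1 tau2 s2 S1 (fun=> 0) = int_rate1 g delta T s2 S1.
Proof.
congr (_ * Rint _ _); apply/funext => l; congr log2.
by rewrite /Seff !mulr0 mul0r !addr0.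
Qed.

End Autocorrelation.
End Pulse.

(** * Limits of the rates and equality of the two regions *)

Theorem theorem1 (R : realType) (T delta tau1 tau2 s2 P1 P2 : R)
    (pr pim : R -> R) :
  0 < T -> 0 < delta -> delta <= 1 ->
  0 <= tau1 -> tau1 <= tau2 -> tau2 <= T ->
  0 < s2 -> 0 < P1 -> 0 < P2 ->
  (* p = pr + j pim is a square-integrable (finite-energy) pulse *)
  measurable_fun setT pr -> measurable_fun setT pim ->
  (lebesgue_measure : set _ -> \bar R).-integrable setT (fun s => ((pr s) ^+ 2)%:E) ->
  (lebesgue_measure : set _ -> \bar R).-integrable setT (fun s => ((pim s) ^+ 2)%:E) ->
  let g := autocorr pr pim in
  abs_summable_Z (fun n => g (n%:~R * delta * T)) ->
  abs_summable_Z (fun n => g (n%:~R * delta * T + (tau1 - tau2))) ->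
  (forall S1 S2 : R -> R,
      admissible g delta T P1 S1 -> admissible g delta T P2 S2 ->
      [/\ rate1_N g delta T s2 S1 @ \oo --> int_rate1 g delta T s2 S1,
          rate2_N g delta T s2 S2 @ \oo --> int_rate2 g delta T s2 S2 &
          ratesum_N g delta T tau1 tau2 s2 S1 S2 @ \oo
            --> int_ratesum g delta T tau1 tau2 s2 S1 S2]) /\
  region_lim g delta T tau1 tau2 s2 P1 P2 = region_int g delta T tau1 tau2 s2 P1 P2.
Proof.
move=> _ _ _ _ _ _ s20 _ _ mpr mpi pr2 pi2 g sg sg12.
have rate_cvg S : spectrum S -> rate1_N g delta T s2 S @ \oo --> int_rate1 g delta T s2 S.
  move=> sp; have := ratesum_cvg mpr mpi pr2 pi2 sg sg12 s20 sp (@spectrum0 R).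
  by rewrite ratesum_N0 int_ratesum0.
have limits S1 S2 : admissible g delta T P1 S1 -> admissible g delta T P2 S2 ->
  [/\ rate1_N g delta T s2 S1 @ \oo --> int_rate1 g delta T s2 S1,
      rate2_N g delta T s2 S2 @ \oo --> int_rate2 g delta T s2 S2 &
      ratesum_N g delta T tau1 tau2 s2 S1 S2 @ \oo
        --> int_ratesum g delta T tau1 tau2 s2 S1 S2].
  move=> [h1 h2 h3 h4 _] [k1 k2 k3 k4 _].
  have sp1 : spectrum S1 by split.
  have sp2 : spectrum S2 by split.
  (* [rate2_N] and [int_rate2] have the same bodies as [rate1_N] and [int_rate1], so one statement
     covers both users. *)
  split; [exact: rate_cvg|exact: rate_cvg|exact: ratesum_cvg].
split; first exact: limits.
have limE S1 S2 : admissible g delta T P1 S1 -> admissible g delta T P2 S2 ->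
  [/\ limn (rate1_N g delta T s2 S1) = int_rate1 g delta T s2 S1,
      limn (rate2_N g delta T s2 S2) = int_rate2 g delta T s2 S2 &
      limn (ratesum_N g delta T tau1 tau2 s2 S1 S2) = int_ratesum g delta T tau1 tau2 s2 S1 S2].
  move=> A1 A2; have [c1 c2 c3] := limits S1 S2 A1 A2.
  by split; apply: cvg_lim => //; exact: Rhausdorff.
rewrite /region_lim /region_int; apply/seteqP; split => x [S1 [S2 [A1 [A2 [x1 x2 x3]]]]];
  exists S1, S2; split; [exact: A1|split; first exact: A2 |exact: A1|split; first exact: A2];
  have [e1 e2 e3] := limE S1 S2 A1 A2.
  by split; [rewrite -e1|rewrite -e2|rewrite -e3].
by split; [rewrite e1|rewrite e2|rewrite e3].
Qed.
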